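(* There is no general recursive function $f:\mathbb{N}\to\mathbb{N}$ such that $f(s^{\mathrm{pre}}_3(n))\ge n$ for all $n\ge1$.
   Context: Graphs are simple undirected graphs viewed as structures for the first-order language with the binary adjacency symbol $\sim$ and equality. A sentence $A$ defines a finite graph $G$ if $A$ is true on $G$ and false on every graph (of any cardinality) not isomorphic to $G$. The length of a formula is its number of symbols, each variable and relation symbol counting as a single symbol. A prenex formula has all its quantifiers up front; its alternation number is the number of changes between $\exists$ and $\forall$ in its quantifier prefix. For a finite graph $G$, $L^{\mathrm{pre}}_3(G)$ is the minimum length of a closed prenex formula with alternation number at most $3$ that defines $G$, and $s^{\mathrm{pre}}_3(n)=\min\{L^{\mathrm{pre}}_3(G): G\text{ has } n\text{ vertices}\}$. *)

(* Defs.v *)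
From Stdlib Require Import List Arith Lia.
Import ListNotations.

Inductive rcode : Type :=
| RZero : rcode
| RSucc : rcode
| RProj : nat -> rcode
| RComp : rcode -> list rcode -> rcode
| RPrec : rcode -> rcode -> rcode
| RMu   : rcode -> rcode.

Inductive reval : rcode -> list nat -> nat -> Prop :=
| ev_zero v : reval RZero v 0
| ev_succ x : reval RSucc [x] (S x)
| ev_proj i v : i < length v -> reval (RProj i) v (nth i v 0)
| ev_comp g hs v ys z :
    reval_list hs v ys -> reval g ys z -> reval (RComp g hs) v z
| ev_prec0 g h v z : reval g v z -> reval (RPrec g h) (0 :: v) z
| ev_precS g h n v y z :
    reval (RPrec g h) (n :: v) y -> reval h (n :: y :: v) z ->
    reval (RPrec g h) (S n :: v) z
| ev_mu g v n :
    reval g (n :: v) 0 ->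
    (forall m, m < n -> exists y, y <> 0 /\ reval g (m :: v) y) ->
    reval (RMu g) v n
with reval_list : list rcode -> list nat -> list nat -> Prop :=
| evl_nil v : reval_list [] v []
| evl_cons h hs v y ys :
    reval h v y -> reval_list hs v ys -> reval_list (h :: hs) v (y :: ys).

Definition general_recursive (f : nat -> nat) : Prop :=
  exists c : rcode, forall n, reval c [n] (f n).

Inductive form : Type :=
| FAdj : nat -> nat -> form
| FEq  : nat -> nat -> form
| FNeg : form -> form
| FAnd : form -> form -> form
| FOr  : form -> form -> form
| FImp : form -> form -> form
| FIff : form -> form -> form
| FEx  : nat -> form -> form
| FAll : nat -> form -> form.

(* Length = number of symbols: variables, relation symbols, connectives,
   quantifiers and parentheses each count as one symbol.  Binary
   connectives are written with a pair of parentheses: (A * B). *)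
Fixpoint flen (A : form) : nat :=
  match A with
  | FAdj _ _ | FEq _ _ => 3
  | FNeg B => 1 + flen B
  | FAnd B C | FOr B C | FImp B C | FIff B C => 3 + flen B + flen C
  | FEx _ B | FAll _ B => 2 + flen B
  end.

Fixpoint free (x : nat) (A : form) : Prop :=
  match A with
  | FAdj y z | FEq y z => x = y \/ x = z
  | FNeg B => free x B
  | FAnd B C | FOr B C | FImp B C | FIff B C => free x B \/ free x C
  | FEx y B | FAll y B => x <> y /\ free x B
  end.

Definition closed (A : form) : Prop := forall x, ~ free x A.

Fixpoint qfree (A : form) : Prop :=
  match A with
  | FAdj _ _ | FEq _ _ => True
  | FNeg B => qfree B
  | FAnd B C | FOr B C | FImp B C | FIff B C => qfree B /\ qfree C
  | FEx _ _ | FAll _ _ => False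
  end.

Fixpoint qprefix (A : form) : list bool :=
  match A with
  | FEx _ B => true :: qprefix B
  | FAll _ B => false :: qprefix B
  | _ => []
  end.

Fixpoint matrix (A : form) : form :=
  match A with
  | FEx _ B | FAll _ B => matrix B
  | _ => A
  end.

Definition prenex (A : form) : Prop := qfree (matrix A).

Fixpoint changes (s : list bool) : nat :=
  match s with
  | a :: ((b :: _) as t) => (if Bool.eqb a b then 0 else 1) + changes t
  | _ => 0
  end.

Definition alternation (A : form) : nat := changes (qprefix A).

Record graph : Type := Graph {
  V : Type;
  adj : V -> V -> Prop;
  adj_sym : forall x y, adj x y -> adj y x;
  adj_irr : forall x, ~ adj x x;
  V_inh : inhabited V
}.

Fixpoint sat (G : graph) (env : nat -> V G) (A : form) : Prop :=
  match A with
  | FAdj x y => adj G (env x) (env y)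
  | FEq x y => env x = env y
  | FNeg B => ~ sat G env B
  | FAnd B C => sat G env B /\ sat G env C
  | FOr B C => sat G env B \/ sat G env C
  | FImp B C => sat G env B -> sat G env C
  | FIff B C => (sat G env B <-> sat G env C)
  | FEx x B => exists v : V G, sat G (fun y => if Nat.eqb y x then v else env y) B
  | FAll x B => forall v : V G, sat G (fun y => if Nat.eqb y x then v else env y) B
  end.

Definition true_on (A : form) (G : graph) : Prop := forall env, sat G env A.

Definition iso (G H : graph) : Prop :=
  exists (f : V G -> V H) (g : V H -> V G),
    (forall x, g (f x) = x) /\ (forall y, f (g y) = y) /\
    (forall x y, adj G x y <-> adj H (f x) (f y)).

Definition defines (A : form) (G : graph) : Prop :=
  true_on A G /\ forall H : graph, ~ iso H G -> ~ true_on A H.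

Definition has_n_vertices (G : graph) (n : nat) : Prop :=
  exists f : nat -> V G,
    (forall v, exists i, i < n /\ f i = v) /\
    (forall i j, i < n -> j < n -> f i = f j -> i = j).

Definition defines_pre3 (A : form) (G : graph) : Prop :=
  closed A /\ prenex A /\ alternation A <= 3 /\ defines A G.

Definition s_pre3 (n m : nat) : Prop :=
  (exists G A, has_n_vertices G n /\ defines_pre3 A G /\ flen A = m) /\
  (forall G A, has_n_vertices G n -> defines_pre3 A G -> m <= flen A).

(* Main.v *)
Require Import Defs.
From Stdlib Require Import List Arith Lia.
From Stdlib Require Import Bool Classical ProofIrrelevance IndefiniteDescription.
Import ListNotations.

(* A halting run of a counter machine is turned into a graph that is pinned down
   by an exists-forall-exists-forall sentence.  The graph consists of finitely
   many markers and of one row of vertices per time step.  The sentence says how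
   the markers and row 0 look, that every non-halting row is followed by a row
   whose adjacencies to all earlier vertices are prescribed by the transition,
   and that a halting row comes after every vertex.  In any model, starting from
   row 0 one is forced to rebuild the actual run row by row; as the run halts,
   the model is finite and isomorphic to the intended graph.

   If f were recursive with f(s(n)) >= n, one would let the machine load k and
   compute the sum of f(j) over j < k^4.  The sentence has length O(k^2), hence
   less than k^4 for some k, while the graph has more vertices than the run has
   steps, thus more than f of its succinctness. *)

(** * From recursive functions to counter machines *)

(** With only three alternations, the innermost part must recognise sorts, rows, their order and
    register values without quantifiers. Sorts are colours given by adjacency to markers; membership
    in a row and precedence are read off fixed adjacency patterns. Counter machines suit this: a
    configuration takes a fixed number of vertices, because a register value is the set of earlier
    tokens seen by one vertex, and two successive values are compared token by token with a single
    universal [Z]. An increment changes exactly one token; it is named by the extra row [U] chosen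
    together with [Y], which saves a further quantifier.

    The obstacle is foreign vertices: a model may be infinite, and a vertex outside the rebuilt rows
    could imitate one inside. The induction along the run therefore carries two invariants:
    [embeds], that the first rows are copied faithfully, and [closed_at], that the formula [upto]
    holds of no vertex outside the copy. [init] and [next_row] each have a clause preserving
    closedness. At the halting row it turns the clause that every vertex is a marker or satisfies
    [upto] into surjectivity, hence isomorphism. *)

Inductive instr : Type :=
| INC : nat -> nat -> instr
| DEC : nat -> nat -> nat -> instr.

Definition upd (r : nat -> nat) (x v : nat) : nat -> nat :=
  fun y => if Nat.eqb y x then v else r y.

Lemma upd_same r x v : upd r x v x = v.
Proof. unfold upd. now rewrite Nat.eqb_refl. Qed.

Lemma upd_other r x v y : y <> x -> upd r x v y = r y.
Proof. intro H. unfold upd. now rewrite (proj2 (Nat.eqb_neq y x) H). Qed.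

Definition machine_step (p : list instr) (c : nat * (nat -> nat)) : nat * (nat -> nat) :=
  let (q, r) := c in
  match nth_error p q with
  | Some (INC x j) => (j, upd r x (S (r x)))
  | Some (DEC x j1 j2) =>
      match r x with 0 => (j1, r) | S n => (j2, upd r x n) end
  | None => c
  end.

(** A structured intermediate language. A loop takes one unit from its register at each entry, which
    is what [DEC] does with its two exits, so a loop costs one instruction. *)
Inductive stmt : Type :=
| SInc : nat -> stmt
| SDec : nat -> stmt
| SSeq : stmt -> stmt -> stmt
| SLoop : nat -> stmt -> stmt.

Inductive exec : stmt -> (nat -> nat) -> (nat -> nat) -> Prop :=
| ex_inc x r : exec (SInc x) r (upd r x (S (r x)))
| ex_dec0 x r : r x = 0 -> exec (SDec x) r r
| ex_decS x r n : r x = S n -> exec (SDec x) r (upd r x n)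
| ex_seq s1 s2 r r1 r2 : exec s1 r r1 -> exec s2 r1 r2 -> exec (SSeq s1 s2) r r2
| ex_loop0 x s r : r x = 0 -> exec (SLoop x s) r r
| ex_loopS x s r n r1 r2 :
    r x = S n -> exec s (upd r x n) r1 -> exec (SLoop x s) r1 r2 ->
    exec (SLoop x s) r r2.

Fixpoint code_len (s : stmt) : nat :=
  match s with
  | SInc _ | SDec _ => 1
  | SSeq s1 s2 => code_len s1 + code_len s2
  | SLoop _ s1 => S (code_len s1)
  end.

(* Code for [s] placed at address [a], leaving to address [x]. *)
Fixpoint code (s : stmt) (a x : nat) : list instr :=
  match s with
  | SInc r => [INC r x]
  | SDec r => [DEC r x x]
  | SSeq s1 s2 => code s1 a (a + code_len s1) ++ code s2 (a + code_len s1) x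
  | SLoop r s1 => DEC r x (S a) :: code s1 (S a) a
  end.

Lemma length_code s : forall a x, length (code s a x) = code_len s.
Proof.
  induction s; intros a x; simpl; auto.
  now rewrite length_app, IHs1, IHs2.
Qed.

Definition instr_ok (m N : nat) (i : instr) : Prop :=
  match i with
  | INC r j => r < m /\ j <= N
  | DEC r j1 j2 => r < m /\ j1 <= N /\ j2 <= N
  end.

Fixpoint reg_bound (s : stmt) : nat :=
  match s with
  | SInc r | SDec r => S r
  | SSeq s1 s2 => Nat.max (reg_bound s1) (reg_bound s2)
  | SLoop r s1 => Nat.max (reg_bound s1) (S r)
  end.

Lemma code_ok m N s : forall a x,
  reg_bound s <= m -> a + code_len s <= N -> x <= N ->
  Forall (instr_ok m N) (code s a x).
Proof.
  induction s; simpl; intros a x Hm Ha Hx.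
  - constructor; [simpl; lia|constructor].
  - constructor; [simpl; lia|constructor].
  - apply Forall_app; split; [apply IHs1|apply IHs2]; lia.
  - constructor; [simpl; lia|apply IHs; lia].
Qed.

Definition code_at (p : list instr) (a : nat) (l : list instr) : Prop :=
  forall i c, nth_error l i = Some c -> nth_error p (a + i) = Some c.

Lemma code_at_app p a l1 l2 :
  code_at p a (l1 ++ l2) -> code_at p a l1 /\ code_at p (a + length l1) l2.
Proof.
  intro H; split; intros i c Hi.
  - apply H. rewrite nth_error_app1; auto.
    apply nth_error_Some. now rewrite Hi.
  - rewrite <- Nat.add_assoc. apply H.
    rewrite nth_error_app2 by lia.
    now replace (length l1 + i - length l1) with i by lia.
Qed.

Lemma code_at_cons p a i l :
  code_at p a (i :: l) -> nth_error p a = Some i /\ code_at p (S a) l.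
Proof.
  intro H; split.
  - replace a with (a + 0) by lia. now apply H.
  - intros k c Hk. replace (S a + k) with (a + S k) by lia. now apply H.
Qed.

Definition reaches (p : list instr) (c d : nat * (nat -> nat)) : Prop :=
  exists n, Nat.iter n (machine_step p) c = d.

Lemma reaches_trans p c d e : reaches p c d -> reaches p d e -> reaches p c e.
Proof.
  intros [n Hn] [k Hk]. exists (k + n). now rewrite Nat.iter_add, Hn.
Qed.

Lemma reaches_step p c d : machine_step p c = d -> reaches p c d.
Proof. now exists 1. Qed.

(** The induction is on the execution and not on the statement: one pass of a loop ends at the
    address of the loop itself, where the same code serves the remaining passes. *)
Lemma code_correct s r r' : exec s r r' ->
  forall p a x, code_at p a (code s a x) -> reaches p (a, r) (x, r').
Proof.
  induction 1; intros p a y Hc.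
  - apply code_at_cons in Hc as [Hc _]. apply reaches_step; simpl. now rewrite Hc.
  - apply code_at_cons in Hc as [Hc _]. apply reaches_step; simpl. now rewrite Hc, H.
  - apply code_at_cons in Hc as [Hc _]. apply reaches_step; simpl. now rewrite Hc, H.
  - simpl in Hc. apply code_at_app in Hc as [H1 H2]. rewrite length_code in H2.
    eapply reaches_trans; [apply IHexec1|apply IHexec2]; eauto.
  - apply code_at_cons in Hc as [Hc _]. apply reaches_step; simpl. now rewrite Hc, H.
  - pose proof Hc as Hc'. apply code_at_cons in Hc' as [H2 H3].
    eapply reaches_trans; [|eapply reaches_trans; [apply IHexec1, H3|apply IHexec2, Hc]].
    apply reaches_step; simpl. now rewrite H2, H.
Qed.

(** * Compiling recursive functions into loop programs *)

Definition sets (s : stmt) (r : nat -> nat) (out z : nat) (keep : nat -> Prop) : Prop :=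
  exists r', exec s r r' /\ r' out = z /\ forall y, keep y -> r' y = r y.

(** The language has no empty statement; the body is a second decrement, harmless at 0. *)
Definition zero (x : nat) : stmt := SLoop x (SDec x).

Lemma zero_sets x r : sets (zero x) r x 0 (fun y => y <> x).
Proof.
  remember (r x) as n eqn:E. revert r E.
  (* A pass removes two units, one at the entry and one in the body, unless only one is left; hence
     the cases 0, 1 and at least 2. *)
  induction n as [n IH] using lt_wf_ind; intros r E. destruct n as [|[|n]].
  - exists r; repeat split; auto. now constructor.
  - exists (upd r x 0). split; [|split].
    + eapply ex_loopS; [eauto|apply ex_dec0|apply ex_loop0]; apply upd_same.
    + apply upd_same.
    + intros; now apply upd_other.
  - destruct (IH n) with (r := upd (upd r x (S n)) x n) as (r' & H1 & H2 & H3);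
      [lia|now rewrite upd_same|].
    exists r'; split; [|split]; auto.
    + eapply ex_loopS; [eauto| |exact H1]. apply ex_decS. apply upd_same.
    + intros y Hy. rewrite H3, !upd_other; auto.
Qed.

(** A loop destroys its counter, so the value of [a] is moved to [b] and [t] at once and then
    restored from [t]. *)
Definition copy (a b t : nat) : stmt :=
  SSeq (zero b) (SSeq (zero t)
    (SSeq (SLoop a (SSeq (SInc b) (SInc t))) (SLoop t (SInc a)))).

Lemma copy_sets a b t r : a <> b -> a <> t -> b <> t ->
  sets (copy a b t) r b (r a) (fun y => y <> b /\ y <> t).
Proof.
  intros ab at_ bt.
  destruct (zero_sets b r) as (r1 & E1 & V1 & K1).
  destruct (zero_sets t r1) as (r2 & E2 & V2 & K2).
  assert (L1 : forall n s, s a = n -> exists s',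
    exec (SLoop a (SSeq (SInc b) (SInc t))) s s' /\ s' a = 0 /\
    s' b = s b + n /\ s' t = s t + n /\
    forall y, y <> a -> y <> b -> y <> t -> s' y = s y).
  { induction n; intros s Hs.
    - exists s; repeat split; auto. now constructor.
    - set (s1 := upd s a n). set (s2 := upd s1 b (S (s1 b))).
      set (s3 := upd s2 t (S (s2 t))).
      destruct (IHn s3) as (s' & A & B & C & D & E).
      { unfold s3, s2, s1. now rewrite !upd_other, upd_same by auto. }
      exists s'. split; [|split; [exact B|]].
      { eapply ex_loopS; [eauto| |exact A]. eapply ex_seq; constructor. }
      split; [|split].
      + rewrite C. unfold s3, s2, s1.
        rewrite upd_other, upd_same, upd_other by auto. lia.
      + rewrite D. unfold s3, s2, s1.
        rewrite upd_same, !upd_other by auto. lia.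
      + intros y H1 H2 H3. rewrite E by auto. unfold s3, s2, s1.
        now rewrite !upd_other by auto. }
  assert (L2 : forall n s, s t = n -> exists s',
    exec (SLoop t (SInc a)) s s' /\ s' a = s a + n /\
    forall y, y <> a -> y <> t -> s' y = s y).
  { induction n; intros s Hs.
    - exists s; repeat split; auto. now constructor.
    - set (s1 := upd s t n). set (s2 := upd s1 a (S (s1 a))).
      destruct (IHn s2) as (s' & A & B & C).
      { unfold s2, s1. now rewrite upd_other, upd_same by auto. }
      exists s'. split; [|split].
      + eapply ex_loopS; [eauto|constructor|exact A].
      + rewrite B. unfold s2, s1. rewrite upd_same, upd_other by auto. lia.
      + intros y H1 H2. rewrite C by auto. unfold s2, s1.
        now rewrite !upd_other by auto. }
  destruct (L1 _ r2 eq_refl) as (r3 & E3 & A3 & B3 & T3 & K3).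
  destruct (L2 _ r3 eq_refl) as (r4 & E4 & A4 & K4).
  assert (r2 a = r a) as Ea by (rewrite K2, K1; auto).
  exists r4. split; [|split].
  - repeat (eapply ex_seq; [eassumption|]). exact E4.
  - rewrite K4 by auto. rewrite B3, K2, V1 by auto. lia.
  - intros y [H1 H2]. destruct (Nat.eq_dec y a) as [->|N].
    + rewrite A4, A3, T3. lia.
    + rewrite K4, K3, K2, K1; auto.
Qed.

(* [fr] bounds the registers in use; those from [fr] on are scratch. *)
Fixpoint compile (c : rcode) (ins : list nat) (out fr : nat) {struct c} : stmt :=
  match c with
  | RZero => zero out
  | RSucc => SSeq (copy (nth 0 ins 0) out fr) (SInc out)
  | RProj i => copy (nth i ins 0) out fr
  | RComp g hs =>
      let top := fr + length hs in
      SSeq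
        ((fix args (l : list rcode) (k : nat) : stmt :=
            match l with
            (* This serves as an empty statement: [out] is not an input and receives its value
               later. *)
            | [] => zero out
            | h :: l' => SSeq (compile h ins k top) (args l' (S k))
            end) hs fr)
        (compile g (seq fr (length hs)) out top)
  (* [fr] counts the rounds done, [fr + 1] holds the current value, [fr + 2] the next one, [fr + 3]
     the rounds left; [fr + 4] is scratch for [copy]. *)
  | RPrec g h =>
      let n := hd 0 ins in let vs := tl ins in
      let top := fr + 5 in
      SSeq (compile g vs (fr + 1) top)
      (SSeq (zero fr) (SSeq (copy n (fr + 3) (fr + 4))
      (SSeq (SLoop (fr + 3)
               (SSeq (compile h (fr :: (fr + 1) :: vs) (fr + 2) top)
               (SSeq (copy (fr + 2) (fr + 1) (fr + 4)) (SInc fr))))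
            (copy (fr + 1) out (fr + 4)))))
  (* [fr] is the candidate and [fr + 1] the value of [g] at it. The decrement at loop entry spoils
     [fr + 1], but the body recomputes it. *)
  | RMu g =>
      let top := fr + 3 in
      SSeq (zero fr)
      (SSeq (compile g (fr :: ins) (fr + 1) top)
      (SSeq (SLoop (fr + 1)
               (SSeq (SInc fr) (compile g (fr :: ins) (fr + 1) top)))
            (copy fr out (fr + 2))))
  end.

(** The anonymous inner fixpoint of [compile], which makes the recursion through [list rcode]
    structural, is given a name here so that lemmas can be stated about it. *)
Fixpoint compile_args (top out : nat) (ins : list nat) (l : list rcode) (k : nat) : stmt :=
  match l with
  | [] => zero out
  | h :: l' => SSeq (compile h ins k top) (compile_args top out ins l' (S k))
  end.

Lemma compile_comp g hs ins out fr :
  compile (RComp g hs) ins out fr =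
  SSeq (compile_args (fr + length hs) out ins hs fr)
       (compile g (seq fr (length hs)) out (fr + length hs)).
Proof.
  simpl. f_equal. generalize (fr + length hs) as top. intro top.
  generalize fr as k. induction hs as [|h hs IH]; intro k; simpl; [reflexivity|].
  now rewrite IH.
Qed.

(** The input registers survive, being below [fr] and different from [out]; loops rely on this when
    they run the same compiled code again on the same inputs. *)
Definition compiles (c : rcode) : Prop := forall ins out fr v z r,
  reval c v z -> map r ins = v -> (forall x, In x ins -> x < fr) ->
  out < fr -> ~ In out ins ->
  sets (compile c ins out fr) r out z (fun y => y < fr /\ y <> out).

Lemma rcode_nested_ind (P : rcode -> Prop) :
  P RZero -> P RSucc -> (forall i, P (RProj i)) ->
  (forall g hs, P g -> Forall P hs -> P (RComp g hs)) ->
  (forall g h, P g -> P h -> P (RPrec g h)) ->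
  (forall g, P g -> P (RMu g)) -> forall c, P c.
Proof.
  intros H1 H2 H3 H4 H5 H6. fix IH 1. intros [| |i|g hs|g h|g].
  - exact H1.
  - exact H2.
  - apply H3.
  - apply H4; [apply IH|]. induction hs; constructor; [apply IH|assumption].
  - apply H5; apply IH.
  - apply H6; apply IH.
Qed.

(** [reval] unfolds a primitive recursion from [n] downwards, whereas the compiled loop works
    upwards from 0; [w] lists the intermediate values that the loop invariant refers to. *)
Lemma rprec_trace g h n v z : reval (RPrec g h) (n :: v) z ->
  exists w, reval g v (w 0) /\
    (forall k, k < n -> reval h (k :: w k :: v) (w (S k))) /\ w n = z.
Proof.
  revert z. induction n as [|n IH]; intros z He; inversion He; subst.
  - exists (fun _ => z). repeat split; auto. intros; lia.
  - destruct (IH y) as (w & W0 & WS & Wn); auto.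
    exists (fun k => if k <=? n then w k else z). repeat split.
    + exact W0.
    + intros k Hk. replace (k <=? n) with true by (symmetry; apply Nat.leb_le; lia).
      destruct (Nat.leb_spec (S k) n).
      * apply WS; lia.
      * replace k with n by lia. now rewrite Wn.
    + now replace (S n <=? n) with false by (symmetry; apply Nat.leb_gt; lia).
Qed.

Lemma compile_args_correct top out ins hs : forall k v ys r,
  Forall compiles hs -> reval_list hs v ys -> map r ins = v ->
  (forall x, In x ins -> x < k) -> out < k -> ~ In out ins ->
  k + length hs <= top ->
  exists r', exec (compile_args top out ins hs k) r r' /\
    map r' (seq k (length hs)) = ys /\
    forall y, y < k -> y <> out -> r' y = r y.
Proof.
  induction hs as [|h hs IH]; intros k v ys r Hc He Hv Hi Ho Hn Ht.
  - inversion He; subst. destruct (zero_sets out r) as (r' & A & B & C).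
    exists r'; repeat split; auto.
  - inversion He as [|? ? ? y ys' E1 E2]; subst. inversion Hc as [|? ? C1 C2]; subst.
    simpl in Ht.
    destruct (C1 ins k top (map r ins) y r) as (r1 & A1 & B1 & K1); auto;
      try (intros; apply Hi in H); try lia.
    { intro H; apply Hi in H; lia. }
    destruct (IH (S k) (map r ins) ys' r1) as (r2 & A2 & B2 & K2); auto; try lia.
    { apply map_ext_in. intros x Hx. apply K1. apply Hi in Hx; lia. }
    { intros x Hx. apply Hi in Hx; lia. }
    exists r2. split; [econstructor; eauto|]. split.
    + simpl. rewrite B2. f_equal. rewrite K2; lia.
    + intros x H1 H2. rewrite K2, K1; lia.
Qed.

Lemma compile_correct c : compiles c.
Proof.
  induction c using rcode_nested_ind; intros ins out fr v z r He Hv Hi Ho Hn.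
  - inversion He; subst. destruct (zero_sets out r) as (r' & A & B & C).
    exists r'; repeat split; auto. intros y [_ Hy]; auto.
  - inversion He; subst. destruct ins as [|i [|]]; try discriminate.
    simpl in H0; injection H0 as H0. simpl in *.
    destruct (copy_sets i out fr r) as (r1 & A & B & C).
    { intro; subst; auto. }
    { specialize (Hi i); lia. }
    { lia. }
    exists (upd r1 out (S (r1 out))). split; [|split].
    + econstructor; [exact A|constructor].
    + rewrite upd_same. lia.
    + intros y [H1 H2]. rewrite upd_other, C; auto. lia.
  - inversion He; subst. rewrite length_map in *.
    assert (Hin : In (nth i ins 0) ins) by (apply nth_In; lia).
    destruct (copy_sets (nth i ins 0) out fr r) as (r1 & A & B & C).
    { intro; subst; auto. }
    { apply Hi in Hin; lia. }
    { lia. }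
    exists r1. split; [exact A|split].
    + rewrite B. rewrite (nth_indep (map r ins) 0 (r 0)) by now rewrite length_map.
      now rewrite map_nth.
    + intros y [H1 H2]. apply C; lia.
  - inversion He as [| | |? ? ? ys ? E1 E2| | |]; subst. rewrite compile_comp.
    destruct (compile_args_correct (fr + length hs) out ins hs fr _ ys r H E1 eq_refl)
      as (r1 & A1 & B1 & K1); auto.
    destruct (IHc (seq fr (length hs)) out (fr + length hs) ys z r1)
      as (r2 & A2 & B2 & K2); auto; try lia.
    { intros x Hx. apply in_seq in Hx; lia. }
    { intro Hx. apply in_seq in Hx; lia. }
    exists r2. split; [econstructor; eauto|split; auto].
    intros y [H1 H2]. rewrite K2, K1; lia.
  - destruct ins as [|i vs]; [subst v; simpl in He; inversion He|].
    simpl in Hv. subst v. set (v := map r vs) in *.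
    assert (Hiv : forall x, In x vs -> x < fr) by (intros; apply Hi; now right).
    assert (Hif : i < fr) by (apply Hi; now left).
    destruct (rprec_trace _ _ _ _ _ He) as (w & Hw0 & HwS & Hwn).
    destruct (IHc1 vs (fr + 1) (fr + 5) v (w 0) r) as (r1 & A1 & B1 & K1); auto; try lia.
    { intros x Hx; apply Hiv in Hx; lia. }
    { intro Hx; apply Hiv in Hx; lia. }
    destruct (zero_sets fr r1) as (r2 & A2 & B2 & K2).
    destruct (copy_sets i (fr + 3) (fr + 4) r2) as (r3 & A3 & B3 & K3); try lia.
    assert (Ei : r2 i = r i) by (rewrite K2, K1; lia).
    set (body := SSeq (compile c2 (fr :: (fr + 1) :: vs) (fr + 2) (fr + 5))
               (SSeq (copy (fr + 2) (fr + 1) (fr + 4)) (SInc fr))).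
    (* Loop invariant: [n] rounds are done, [d] are left, and the value held is [w n]. *)
    assert (L : forall d n s, s (fr + 3) = d -> d + n = r i -> s fr = n ->
      s (fr + 1) = w n -> (forall y, y < fr -> s y = r y) -> exists s',
      exec (SLoop (fr + 3) body) s s' /\ s' (fr + 1) = w (r i) /\
      (forall y, y < fr -> s' y = r y)).
    { induction d; intros n s Hd Hdn Hf Hev Hk.
      - exists s. split; [now constructor|]. split; auto. now rewrite <- Hdn.
      - set (s0 := upd s (fr + 3) d).
        destruct (IHc2 (fr :: (fr + 1) :: vs) (fr + 2) (fr + 5) (n :: w n :: v)
                       (w (S n)) s0) as (s1 & C1 & D1 & J1); auto; try lia.
        { apply HwS; lia. }
        { simpl. unfold s0. rewrite !upd_other by lia. rewrite Hf, Hev. do 2 f_equal.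
          apply map_ext_in. intros x Hx. apply Hiv in Hx. rewrite upd_other; auto; lia. }
        { intros x [Hx|[Hx|Hx]]; [| |apply Hiv in Hx]; lia. }
        { intros [Hx|[Hx|Hx]]; [| |apply Hiv in Hx]; lia. }
        destruct (copy_sets (fr + 2) (fr + 1) (fr + 4) s1) as (s2 & C2 & D2 & J2); try lia.
        destruct (IHd (S n) (upd s2 fr (S (s2 fr)))) as (s' & C & D & E).
        + rewrite upd_other, J2, J1 by lia. unfold s0. apply upd_same.
        + lia.
        + rewrite upd_same, J2, J1 by lia. unfold s0. rewrite upd_other; lia.
        + rewrite upd_other, D2, D1 by lia. reflexivity.
        + intros x Hx. rewrite upd_other, J2, J1 by lia. unfold s0.
          rewrite upd_other; auto; lia.
        + exists s'. split; [|split; auto].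
          eapply ex_loopS; [exact Hd| |exact C].
          econstructor; [exact C1|]. econstructor; [exact C2|constructor]. }
    destruct (L (r i) 0 r3) as (r4 & A4 & B4 & K4).
    { now rewrite B3. }
    { lia. }
    { rewrite K3, B2; lia. }
    { rewrite K3, K2, B1; lia. }
    { intros y Hy. rewrite K3, K2, K1; lia. }
    destruct (copy_sets (fr + 1) out (fr + 4) r4) as (r5 & A5 & B5 & K5); try lia.
    exists r5. split; [|split].
    + simpl. repeat (eapply ex_seq; [eassumption|]). exact A5.
    + rewrite B5, B4. exact Hwn.
    + intros y [H1 H2]. rewrite K5 by lia. auto.
  - inversion He as [| | | | | |? ? ? H1 H2]; subst. set (v := map r ins) in *.
    (* One evaluation of [g] at the candidate [j]: its value vanishes exactly when [j] has reached
       [z], so it can control the loop. *)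
    assert (Hw : forall j s, j <= z -> s fr = j -> (forall y, y < fr -> s y = r y) ->
      exists w s', reval c (j :: v) w /\ (j < z -> w <> 0) /\ (j = z -> w = 0) /\
      exec (compile c (fr :: ins) (fr + 1) (fr + 3)) s s' /\ s' (fr + 1) = w /\
      s' fr = j /\ (forall y, y < fr -> s' y = r y)).
    { intros j s Hj Hf Hk.
      assert (exists w, reval c (j :: v) w /\ (j < z -> w <> 0) /\ (j = z -> w = 0))
        as (w & E & W1 & W2).
      { destruct (Nat.eq_dec j z) as [->|N].
        - exists 0; repeat split; auto; lia.
        - destruct (H2 j) as (w & W & E); [lia|]. exists w; repeat split; auto; lia. }
      destruct (IHc (fr :: ins) (fr + 1) (fr + 3) (j :: v) w s) as (s' & A & B & C); auto;
        try lia.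
      { simpl. rewrite Hf. f_equal. apply map_ext_in. intros; apply Hk, Hi; auto. }
      { intros x [Hx|Hx]; [|apply Hi in Hx]; lia. }
      { intros [Hx|Hx]; [|apply Hi in Hx]; lia. }
      exists w, s'; repeat split; auto.
      - rewrite C; auto; lia.
      - intros y Hy. rewrite C; auto; lia. }
    destruct (zero_sets fr r) as (r1 & A1 & B1 & K1).
    destruct (Hw 0 r1) as (w & r2 & _ & W1 & W2 & A2 & B2 & C2 & K2); auto; try lia.
    { intros; apply K1; lia. }
    set (body := SSeq (SInc fr) (compile c (fr :: ins) (fr + 1) (fr + 3))).
    assert (L : forall d j s, d + j = z -> s fr = j ->
      (j < z -> s (fr + 1) <> 0) -> (j = z -> s (fr + 1) = 0) ->
      (forall y, y < fr -> s y = r y) -> exists s',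
      exec (SLoop (fr + 1) body) s s' /\ s' fr = z /\ (forall y, y < fr -> s' y = r y)).
    { induction d; intros j s Hd Hf Hp Hz Hk.
      - exists s. split; [constructor; apply Hz; lia|]. split; auto; lia.
      - destruct (s (fr + 1)) as [|n] eqn:En; [exfalso; apply Hp; lia|].
        set (s0 := upd s (fr + 1) n). set (s1 := upd s0 fr (S (s0 fr))).
        destruct (Hw (S j) s1) as (w' & s2 & _ & V1 & V2 & A & B & C & K); try lia.
        { unfold s1, s0. rewrite upd_same, upd_other; lia. }
        { intros y Hy. unfold s1, s0. rewrite !upd_other by lia. auto. }
        subst w'.
        destruct (IHd (S j) s2) as (s' & D & E & F); auto; try lia.
        exists s'. split; [|split; auto].
        eapply ex_loopS; [exact En| |exact D]. econstructor; [constructor|exact A]. }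
    subst w.
    destruct (L z 0 r2) as (r3 & A3 & B3 & K3); auto; try lia.
    destruct (copy_sets fr out (fr + 2) r3) as (r4 & A4 & B4 & K4); try lia.
    exists r4. split; [|split].
    + simpl. repeat (eapply ex_seq; [eassumption|]). exact A4.
    + now rewrite B4.
    + intros y [H3 H4]. rewrite K4 by lia. auto.
Qed.

(** * Sums of a recursive function, and machines computing them *)

Definition rc_add : rcode := RPrec (RProj 0) (RComp RSucc [RProj 1]).
Definition rc_mul : rcode := RPrec RZero (RComp rc_add [RProj 1; RProj 2]).
Definition rc_square : rcode := RComp rc_mul [RProj 0; RProj 0].
Definition rc_sum (c : rcode) : rcode :=
  RPrec RZero (RComp rc_add [RProj 1; RComp c [RProj 0]]).

Lemma reval_proj i v x : nth_error v i = Some x -> reval (RProj i) v x.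
Proof.
  intro H. rewrite <- (nth_error_nth v i 0 H). constructor.
  apply nth_error_Some. now rewrite H.
Qed.

Lemma reval_add a b : reval rc_add [a; b] (a + b).
Proof.
  induction a; simpl.
  - constructor. now apply reval_proj.
  - econstructor; [exact IHa|].
    econstructor; [|constructor]. econstructor; [now apply reval_proj|constructor].
Qed.

Lemma reval_comp2 g h1 h2 v a b z :
  reval h1 v a -> reval h2 v b -> reval g [a; b] z -> reval (RComp g [h1; h2]) v z.
Proof. intros. repeat econstructor; eauto. Qed.

Lemma reval_mul a b : reval rc_mul [a; b] (a * b).
Proof.
  induction a.
  - simpl. constructor. constructor.
  - econstructor; [exact IHa|]. simpl. rewrite Nat.add_comm.
    eapply reval_comp2; [now apply reval_proj|now apply reval_proj|apply reval_add].
Qed.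

Lemma reval_square a : reval rc_square [a] (a * a).
Proof.
  eapply reval_comp2; [now apply reval_proj|now apply reval_proj|apply reval_mul].
Qed.

Fixpoint sum_below (f : nat -> nat) (n : nat) : nat :=
  match n with 0 => 0 | S k => sum_below f k + f k end.

Lemma reval_sum c f : (forall n, reval c [n] (f n)) ->
  forall n, reval (rc_sum c) [n] (sum_below f n).
Proof.
  intros Hc n. induction n; simpl.
  - repeat constructor.
  - econstructor; [exact IHn|].
    eapply reval_comp2; [now apply reval_proj| |apply reval_add].
    econstructor; [|apply Hc]. econstructor; [now apply reval_proj|constructor].
Qed.

(** This is why a sum is computed: only an upper bound on the succinctness will be known, and [f]
    need not be monotone, so all values below the bound are majorised at once. *)
Lemma le_sum_below f n k : k < n -> f k <= sum_below f n.
Proof.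
  induction n; intro H; [lia|]. simpl.
  destruct (Nat.eq_dec k n) as [->|]; [lia|]. assert (k < n) by lia. intuition lia.
Qed.

(** Runs start with all registers zero, so the argument is supplied by [k] increments at the head of
    the program. *)
Fixpoint load (k : nat) (s : stmt) : stmt :=
  match k with 0 => s | S k' => SSeq (SInc 0) (load k' s) end.

Lemma code_len_load k s : code_len (load k s) = k + code_len s.
Proof. induction k; simpl; auto. Qed.

Lemma reg_bound_load k s m : reg_bound s <= m -> 1 <= m -> reg_bound (load k s) <= m.
Proof.
  intros H H1. induction k; [exact H|]. cbn [load reg_bound].
  apply Nat.max_lub; auto.
Qed.

Lemma exec_load s z out keep : forall k r,
  (forall r', r' 0 = k + r 0 -> sets s r' out z keep) ->
  exists r', exec (load k s) r r' /\ r' out = z.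
Proof.
  induction k; intros r H.
  - destruct (H r eq_refl) as (r' & A & B & _); eauto.
  - destruct (IHk (upd r 0 (S (r 0)))) as (r' & A & B).
    + intros r' Hr. apply H. rewrite upd_same in Hr. lia.
    + exists r'; split; auto. econstructor; [constructor|exact A].
Qed.

(** The number [m] of registers and the overhead [q] are fixed before [k]; therefore the number of
    markers, and with it the size of the tables in the sentence, is governed by [k] alone up to a
    constant. *)
Lemma machine_for c f : (forall n, reval c [n] (f n)) ->
  exists m q, forall k, exists p, length p = k + q /\
    Forall (instr_ok m (length p)) p /\
    exists r x, reaches p (0, fun _ => 0) (length p, r) /\ r x = f k.
Proof.
  intro Hc. set (s := compile c [0] 1 2).
  exists (S (reg_bound s)), (code_len s). intro k.
  (* The exit address is the length of the program: to halt is to run off its end. *)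
  set (p := code (load k s) 0 (k + code_len s)).
  assert (Hl : length p = k + code_len s) by (unfold p; now rewrite length_code, code_len_load).
  exists p. split; [exact Hl|]. split.
  - rewrite Hl. apply code_ok; [apply reg_bound_load; lia|rewrite code_len_load; lia|lia].
  - destruct (exec_load s (f k) 1 (fun y => y < 2 /\ y <> 1) k (fun _ => 0)) as (r & A & B).
    { intros r' Hr. apply compile_correct with (v := [k]); auto.
      - simpl. now rewrite Hr, Nat.add_0_r.
      - intros x [<-|[]]; lia.
      - intros [H|[]]; discriminate. }
    exists r, 1. split; auto. rewrite Hl.
    apply (code_correct _ _ _ A). intros i d Hi. exact Hi.
Qed.

Record run (p : list instr) (m T : nat) (st : nat -> nat) (rg : nat -> nat -> nat) : Prop := {
  run_init_st : st 0 = 0;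
  run_init_rg : forall i, rg 0 i = 0;
  run_regs : forall q i, nth_error p q = Some i -> instr_ok m (length p) i;
  run_halt : st T = length p;
  run_live : forall t, t < T -> st t < length p;
  run_step : forall t, t < T -> (st (S t), rg (S t)) = machine_step p (st t, rg t)
}.

(** A register grows by at most one per step, so a large output forces a long run. *)
Lemma machine_run p m n r : Forall (instr_ok m (length p)) p ->
  Nat.iter n (machine_step p) (0, fun _ => 0) = (length p, r) ->
  exists T st rg, run p m T st rg /\ forall x, r x <= T.
Proof.
  intros Hok Hn.
  set (cfg t := Nat.iter t (machine_step p) (0, fun _ : nat => 0)).
  assert (Hle : forall t, fst (cfg t) <= length p).
  { induction t; simpl; [lia|]. unfold cfg in *; simpl.
    destruct (Nat.iter t (machine_step p) (0, fun _ : nat => 0)) as [q s]; simpl in *.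
    destruct (nth_error p q) as [i|] eqn:E; [|exact IHt].
    rewrite Forall_forall in Hok. specialize (Hok i (nth_error_In _ _ E)).
    destruct i as [x j|x j1 j2]; simpl in *; [lia|].
    destruct (s x); simpl; lia. }
  assert (Hrg : forall t x, snd (cfg t) x <= t).
  { induction t; intro x; simpl; [lia|]. unfold cfg in *; simpl.
    destruct (Nat.iter t (machine_step p) (0, fun _ : nat => 0)) as [q s]; simpl in *.
    specialize (IHt x) as Hx.
    destruct (nth_error p q) as [[y j|y j1 j2]|]; simpl.
    - unfold upd. destruct (Nat.eqb_spec x y); [subst|]; lia.
    - destruct (s y) eqn:E; simpl; [lia|].
      unfold upd. destruct (Nat.eqb_spec x y); [subst|]; lia.
    - lia. }
  (* The given time [n] may come after the halt. [T] is the first halting time; the configuration is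
     constant from then on, so the output is already present at [T]. *)
  assert (Hhalt : exists T, T <= n /\ fst (cfg T) = length p /\
                    forall t, t < T -> fst (cfg t) <> length p).
  { assert (fst (cfg n) = length p) as H by (unfold cfg; now rewrite Hn).
    clear - H. induction n as [n IH] using lt_wf_ind.
    destruct (classic (exists t, t < n /\ fst (cfg t) = length p)) as [(t & A & B)|N].
    - destruct (IH t A B) as (T & C & D & E). exists T; repeat split; auto; lia.
    - exists n; repeat split; auto. intros t Ht E; apply N; eauto. }
  destruct Hhalt as (T & HTn & HT & Hlive).
  assert (Hstay : forall d, cfg (d + T) = cfg T).
  { induction d; auto. unfold cfg in *; simpl. rewrite IHd.
    destruct (Nat.iter T _ _) as [q s]; simpl in *. subst q.
    now rewrite (proj2 (nth_error_None p (length p)) (le_n _)). }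
  exists T, (fun t => fst (cfg t)), (fun t => snd (cfg t)). split.
  - constructor; auto.
    + intros q i Hq. rewrite Forall_forall in Hok. apply Hok. eapply nth_error_In; eauto.
    + intros t Ht. specialize (Hlive t Ht). specialize (Hle t). lia.
    + intros t _. rewrite <- !surjective_pairing. reflexivity.
  - intro x. specialize (Hrg T x). rewrite <- (Hstay (n - T)) in Hrg.
    replace (n - T + T) with n in Hrg by lia. unfold cfg in Hrg. now rewrite Hn in Hrg.
Qed.

(** Used in two ways: the row whose number is a register value already exists when the register is
    changed, and a register vertex never sees the token of its own row or of a later one. *)
Lemma run_rg_le p m T st rg : run p m T st rg -> forall t i, t <= T -> rg t i <= t.
Proof.
  intros R. induction t; intros i Ht.
  - now rewrite (run_init_rg _ _ _ _ _ R).
  - pose proof (run_step _ _ _ _ _ R t ltac:(lia)) as E. unfold machine_step in E.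
    pose proof (IHt i ltac:(lia)) as Hi.
    destruct (nth_error p (st t)) as [[x j|x j1 j2]|].
    + injection E as _ ->. unfold upd. destruct (Nat.eqb_spec i x); [subst|]; lia.
    + destruct (rg t x) eqn:Ex; injection E as _ ->; [lia|].
      unfold upd. destruct (Nat.eqb_spec i x); [subst|]; lia.
    + injection E as _ ->. lia.
Qed.

(** * The sentence *)

Fixpoint exs (a n : nat) (A : form) : form :=
  match n with 0 => A | S n' => FEx a (exs (S a) n' A) end.

Fixpoint alls (a n : nat) (A : form) : form :=
  match n with 0 => A | S n' => FAll a (alls (S a) n' A) end.

Definition agree {V : Type} (a n : nat) (e e' : nat -> V) : Prop :=
  forall x, x < a \/ a + n <= x -> e' x = e x.

Lemma sat_ext G A : forall e e', (forall x, e x = e' x) -> sat G e A <-> sat G e' A.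
Proof.
  induction A; intros e e' H; simpl; rewrite ?H; try tauto;
    try (now rewrite (IHA e e' H));
    try (now rewrite (IHA1 e e' H), (IHA2 e e' H)).
  - split; intros [v Hv]; exists v; (eapply IHA; [|exact Hv]); intro y; simpl;
      destruct (Nat.eqb y n); auto.
  - split; intros Hv v; (eapply IHA; [|exact (Hv v)]); intro y; simpl;
      destruct (Nat.eqb y n); auto.
Qed.

Lemma sat_exs G A : forall n a e,
  sat G e (exs a n A) <-> exists e', agree a n e e' /\ sat G e' A.
Proof.
  induction n as [|n IH]; intros a e; simpl.
  - split.
    + intro H; exists e; split; auto. now intros x _.
    + intros (e' & H & S). eapply sat_ext; [|exact S]. intro x; symmetry; apply H; lia.
  - split.
    + intros [v Hv]. apply IH in Hv as (e' & H & S). exists e'; split; auto.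
      intros x Hx. rewrite H by lia. now rewrite (proj2 (Nat.eqb_neq x a)) by lia.
    + intros (e' & H & S). exists (e' a). apply IH. exists e'; split; auto.
      intros x Hx. destruct (Nat.eqb_spec x a); [now subst|]. apply H; lia.
Qed.

Lemma sat_alls G A : forall n a e,
  sat G e (alls a n A) <-> forall e', agree a n e e' -> sat G e' A.
Proof.
  induction n as [|n IH]; intros a e; simpl.
  - split.
    + intros S e' H. eapply sat_ext; [|exact S]. intro x; apply H; lia.
    + intro S; apply S. now intros x _.
  - split.
    + intros S e' H. specialize (S (e' a)). apply (IH (Datatypes.S a)) with (e' := e') in S; auto.
      intros x Hx. destruct (Nat.eqb_spec x a); [now subst|]. apply H; lia.
    + intros S v. apply IH. intros e' H. apply S. intros x Hx.
      rewrite H by lia. now rewrite (proj2 (Nat.eqb_neq x a)) by lia.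
Qed.

Fixpoint conjs (l : list form) : form :=
  match l with [] => FEq 0 0 | A :: l' => FAnd A (conjs l') end.

Fixpoint disjs (l : list form) : form :=
  match l with [] => FNeg (FEq 0 0) | A :: l' => FOr A (disjs l') end.

Definition conjn (n : nat) (h : nat -> form) : form := conjs (map h (seq 0 n)).
Definition disjn (n : nat) (h : nat -> form) : form := disjs (map h (seq 0 n)).

Definition lit (b : bool) (A : form) : form := if b then A else FNeg A.

Lemma sat_conjn G e n h : sat G e (conjn n h) <-> forall i, i < n -> sat G e (h i).
Proof.
  assert (H : forall l, sat G e (conjs (map h l)) <-> forall i, In i l -> sat G e (h i)).
  { induction l; simpl; [|rewrite IHl]; firstorder congruence. }
  unfold conjn. rewrite H. split; intros K i Hi; apply K; [apply in_seq|apply in_seq in Hi]; lia.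
Qed.

Lemma sat_disjn G e n h : sat G e (disjn n h) <-> exists i, i < n /\ sat G e (h i).
Proof.
  assert (H : forall l, sat G e (disjs (map h l)) <-> exists i, In i l /\ sat G e (h i)).
  { induction l; simpl; [|rewrite IHl]; firstorder congruence. }
  unfold disjn. rewrite H. split; intros (i & Hi & K); exists i; split; auto;
    [apply in_seq in Hi|apply in_seq]; lia.
Qed.

Lemma sat_lit G e b A : sat G e (lit b A) <-> (sat G e A <-> b = true).
Proof. destruct b; simpl; intuition discriminate. Qed.

(** A single check for two purposes: it gives prenexness through the absence of quantifiers, and
    closedness through the bound on the variables. *)
Fixpoint basic (n : nat) (A : form) : Prop :=
  match A with
  | FAdj x y | FEq x y => x < n /\ y < n
  | FNeg B => basic n B
  | FAnd B C | FOr B C | FImp B C | FIff B C => basic n B /\ basic n C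
  | FEx _ _ | FAll _ _ => False
  end.

Lemma basic_qfree n A : basic n A -> qfree A.
Proof. induction A; simpl; tauto. Qed.

Lemma basic_free n A x : basic n A -> free x A -> x < n.
Proof. induction A; simpl; try tauto; intuition (subst; auto). Qed.

Lemma basic_conjn n k h : 0 < n -> (forall i, i < k -> basic n (h i)) -> basic n (conjn k h).
Proof.
  intros H0 H. unfold conjn.
  assert (K : forall i, In i (seq 0 k) -> basic n (h i)) by (intros i Hi; apply H; apply in_seq in Hi; lia).
  induction (seq 0 k); simpl in *; auto.
Qed.

Lemma basic_disjn n k h : 0 < n -> (forall i, i < k -> basic n (h i)) -> basic n (disjn k h).
Proof.
  intros H0 H. unfold disjn.
  assert (K : forall i, In i (seq 0 k) -> basic n (h i)) by (intros i Hi; apply H; apply in_seq in Hi; lia).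
  induction (seq 0 k); simpl in *; auto.
Qed.

Lemma flen_conjn k h b : (forall i, i < k -> flen (h i) <= b) ->
  flen (conjn k h) <= 3 + k * (3 + b).
Proof.
  intro H. unfold conjn.
  assert (K : forall i, In i (seq 0 k) -> flen (h i) <= b) by (intros i Hi; apply H; apply in_seq in Hi; lia).
  rewrite <- (length_seq k 0) at 2. induction (seq 0 k) as [|i l IH]; simpl in *; [lia|].
  specialize (IH (fun i Hi => K i (or_intror Hi))). specialize (K i (or_introl eq_refl)). lia.
Qed.

Lemma flen_disjn k h b : (forall i, i < k -> flen (h i) <= b) ->
  flen (disjn k h) <= 4 + k * (3 + b).
Proof.
  intro H. unfold disjn.
  assert (K : forall i, In i (seq 0 k) -> flen (h i) <= b) by (intros i Hi; apply H; apply in_seq in Hi; lia).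
  rewrite <- (length_seq k 0) at 2. induction (seq 0 k) as [|i l IH]; simpl in *; [lia|].
  specialize (IH (fun i Hi => K i (or_intror Hi))). specialize (K i (or_introl eq_refl)). lia.
Qed.

Lemma flen_lit b A : flen (lit b A) <= 1 + flen A.
Proof. destruct b; simpl; lia. Qed.

#[global] Arguments conjn : simpl never.
#[global] Arguments disjn : simpl never.

Definition sorts (m : nat) : nat := 3 + m.
#[global] Arguments sorts : simpl never.

Section Sentence.

Context (m : nat) (p : list instr).

Local Notation J := (sorts m).
Local Notation Q := (length p).

(* Markers [M], [S] and row [0] are the first existential block; then come a row
   [X], its successor [Y] together with the row [U] of the number that the step
   adds to or removes from a register, and an arbitrary vertex [Z]. *)
Definition var_M (j : nat) : nat := j.
Definition var_S (q : nat) : nat := J + q.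
Definition var_0 (j : nat) : nat := J + S Q + j.
Definition var_X (j : nat) : nat := J + S Q + J + j.
Definition var_Y (j : nat) : nat := J + S Q + J + J + j.
Definition var_U (j : nat) : nat := J + S Q + J + J + J + j.
Definition var_Z : nat := J + S Q + J + J + J + J.

(* Adjacency between the vertices of sorts [i] and [j] of a common row. *)
Definition row_adj (i j : nat) : bool :=
  let h i j := (i =? 0) && ((j =? 1) || (3 <=? j)) || (i =? 2) && ((j =? 0) || (3 <=? j)) in
  h i j || h j i.

(** The markers act as colours that fix the sort of each vertex. Contacts of sort 0 with the state
    markers are left to [state]. *)
Definition row (f : nat -> nat) : form :=
  FAnd (conjn J (fun i => conjn J (fun j => lit (i =? j) (FAdj (f i) (var_M j)))))
  (FAnd (conjn J (fun i => conjn J (fun j => lit (row_adj i j) (FAdj (f i) (f j)))))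
        (conjn (2 + m) (fun i => conjn (S Q) (fun q => FNeg (FAdj (f (S i)) (var_S q)))))).

Definition state (f : nat -> nat) (s : nat) : form :=
  conjn (S Q) (fun q => lit (q =? s) (FAdj (f 0) (var_S q))).

Definition in_row (f : nat -> nat) (w : nat) : form := disjn J (fun j => FEq w (f j)).

(* [w] lies in row [f] or in an earlier one: the vertex [f 2] sees the earlier
   vertices of all sorts but 2, and those of sort 2 are the ones not seeing [f 0]. *)
Definition upto (f : nat -> nat) (w : nat) : form :=
  FOr (in_row f w)
  (FOr (FAnd (FAdj w (f 2)) (FNeg (FEq w (var_M 2))))
       (FAnd (FAdj w (var_M 2)) (FNeg (FAdj w (f 0))))).

Definition marker (w : nat) : form :=
  FOr (in_row var_M w) (disjn (S Q) (fun q => FEq w (var_S q))).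

(** That registers start at 0 is implied: the only token in row 0 is its own, and [row_adj] keeps it
    apart from the register vertices. The last implication is closedness at time 0. *)
Definition init : form :=
  FAnd (conjn J (fun i => conjn J (fun j =>
         FAnd (lit (i =? j) (FEq (var_M i) (var_M j))) (FNeg (FAdj (var_M i) (var_M j))))))
  (FAnd (conjn J (fun i => conjn (S Q) (fun q =>
         FAnd (FNeg (FEq (var_M i) (var_S q))) (FNeg (FAdj (var_M i) (var_S q))))))
  (FAnd (conjn (S Q) (fun q => conjn (S Q) (fun s =>
         FAnd (lit (q =? s) (FEq (var_S q) (var_S s))) (FNeg (FAdj (var_S q) (var_S s))))))
  (FAnd (row var_0) (FAnd (state var_0 0) (FImp (upto var_0 var_Z) (in_row var_0 var_Z)))))).

(** For [x = m] no register is exempt, so everything is kept; the zero branch of [DEC] uses this. *)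
Definition update (x : nat) (A : form) : form :=
  conjn m (fun i => if i =? x then A
                    else FIff (FAdj var_Z (var_Y (3 + i))) (FAdj var_Z (var_X (3 + i)))).

Definition token : form := FAnd (upto var_X var_Z) (FAdj var_Z (var_M 1)).

(** The order vertex of a row sees the tokens of strictly earlier rows only, so [upto_u] has to add
    the token of row [U] itself. *)
Definition below_u : form := FAdj var_Z (var_U 2).
Definition upto_u : form := FOr (FAdj var_Z (var_U 2)) (FEq var_Z (var_U 1)).

(* Register [x] has a set of tokens as its value, always the tokens of an initial
   segment of rows; for INC and DEC it must pass from [A] to [B]. *)
Definition change (x : nat) (A B : form) : form :=
  FImp token (update x (FAnd (FIff (FAdj var_Z (var_X (3 + x))) A)
                             (FIff (FAdj var_Z (var_Y (3 + x))) B))).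

(** A value is an initial segment of the tokens, hence non-zero exactly if it contains the token of
    row 0. The conditions on the old value force [U] to be the first row outside the segment for
    [INC] and the last one inside it for [DEC]. *)
Definition effect (i : instr) : form :=
  match i with
  | INC x j => FAnd (state var_Y j) (change x below_u upto_u)
  | DEC x j1 j2 =>
      FAnd (FImp (FNeg (FAdj (var_X (3 + x)) (var_0 1)))
              (FAnd (state var_Y j1) (FImp token (update m (FEq 0 0)))))
           (FImp (FAdj (var_X (3 + x)) (var_0 1))
              (FAnd (state var_Y j2) (change x upto_u below_u)))
  end.

(** Exactly what is needed to prolong a copy of the first rows: [Y] is new, [U] is old, closedness
    passes from [X] to [Y], and the contacts of [Y] with old rows are prescribed. Those with markers
    and inside [Y] come from [row] and, through [effect], from [state]. *)
Definition next_row : form :=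
  FAnd (row var_Y)
  (FAnd (row var_U)
  (FAnd (conjn J (fun j => upto var_X (var_U j)))
  (FAnd (conjn J (fun j => FNeg (upto var_X (var_Y j))))
  (FAnd (FImp (upto var_Y var_Z) (FOr (upto var_X var_Z) (in_row var_Y var_Z)))
  (FAnd (FImp (upto var_X var_Z)
           (FAnd (FNeg (FAdj var_Z (var_Y 0)))
           (FAnd (FNeg (FAdj var_Z (var_Y 1)))
           (FAnd (FIff (FAdj var_Z (var_Y 2)) (FNeg (FAdj var_Z (var_M 2))))
                 (FImp (FNeg (FAdj var_Z (var_M 1)))
                       (conjn m (fun i => FNeg (FAdj var_Z (var_Y (3 + i))))))))))
        (conjn Q (fun q => FImp (FAdj (var_X 0) (var_S q)) (effect (nth q p (INC 0 0)))))))))).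

Definition body : form :=
  FAnd init
    (FImp (row var_X)
       (FAnd (FImp (FAdj (var_X 0) (var_S Q)) (FOr (marker var_Z) (upto var_X var_Z)))
             (FImp (FNeg (FAdj (var_X 0) (var_S Q))) next_row))).

Definition sentence : form :=
  exs 0 (J + S Q + J)
    (alls (J + S Q + J) J
       (exs (J + S Q + J + J) (J + J)
          (FAll var_Z body))).

Lemma sat_row K e f : sat K e (row f) <->
  (forall i j, i < J -> j < J -> (adj K (e (f i)) (e (var_M j)) <-> i = j)) /\
  (forall i j, i < J -> j < J -> (adj K (e (f i)) (e (f j)) <-> row_adj i j = true)) /\
  (forall i q, 0 < i < J -> q <= Q -> ~ adj K (e (f i)) (e (var_S q))).
Proof.
  unfold row. cbn [sat]. rewrite !sat_conjn.
  split; intros (H1 & H2 & H3); split; [|split| |split].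
  - intros i j Hi Hj. specialize (H1 i Hi). rewrite sat_conjn in H1.
    specialize (H1 j Hj). rewrite sat_lit, Nat.eqb_eq in H1. exact H1.
  - intros i j Hi Hj. specialize (H2 i Hi). rewrite sat_conjn in H2.
    specialize (H2 j Hj). rewrite sat_lit in H2. exact H2.
  - intros [|i] q Hi Hq; [lia|]. unfold sorts in Hi.
    specialize (H3 i ltac:(lia)). rewrite sat_conjn in H3. apply (H3 q); lia.
  - intros i Hi. rewrite sat_conjn. intros j Hj. rewrite sat_lit, Nat.eqb_eq. now apply H1.
  - intros i Hi. rewrite sat_conjn. intros j Hj. rewrite sat_lit. now apply H2.
  - intros i Hi. rewrite sat_conjn. intros q Hq. apply H3; unfold sorts; lia.
Qed.

Lemma sat_state K e f s : sat K e (state f s) <->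
  forall q, q <= Q -> (adj K (e (f 0)) (e (var_S q)) <-> q = s).
Proof.
  unfold state. rewrite sat_conjn.
  split; intros H q Hq; specialize (H q ltac:(lia)); rewrite sat_lit, Nat.eqb_eq in *; exact H.
Qed.

Lemma sat_in_row K e f w : sat K e (in_row f w) <-> exists j, j < J /\ e w = e (f j).
Proof. apply sat_disjn. Qed.

Lemma sat_upto K e f w : sat K e (upto f w) <->
  (exists j, j < J /\ e w = e (f j)) \/
  (adj K (e w) (e (f 2)) /\ e w <> e (var_M 2)) \/
  (adj K (e w) (e (var_M 2)) /\ ~ adj K (e w) (e (f 0))).
Proof. unfold upto. cbn [sat]. now rewrite sat_in_row. Qed.

Lemma sat_marker K e w : sat K e (marker w) <->
  (exists j, j < J /\ e w = e (var_M j)) \/ (exists q, q <= Q /\ e w = e (var_S q)).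
Proof.
  unfold marker. cbn [sat]. rewrite sat_in_row, sat_disjn.
  split; (intros [H|(q & Hq & H)]; [left; exact H|right; exists q; split; [lia|exact H]]).
Qed.

Lemma sat_update K e x A : sat K e (update x A) <-> forall i, i < m ->
  if i =? x then sat K e A
  else (adj K (e var_Z) (e (var_Y (3 + i))) <-> adj K (e var_Z) (e (var_X (3 + i)))).
Proof.
  unfold update. rewrite sat_conjn.
  split; intros H i Hi; specialize (H i Hi); destruct (i =? x); exact H.
Qed.

End Sentence.

(** * The intended model *)

(* Sort markers, state markers, and the vertex of sort [j] in row [t].  Sort 0
   ties each row together and carries the state, 1 holds the tokens counted by the
   registers, 2 orders the rows, and [3 + i] stands for register [i]. *)
Inductive vertex : Type :=
| VM : nat -> vertex
| VS : nat -> vertex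
| VX : nat -> nat -> vertex.

Section Model.

Context (m : nat) (p : list instr) (T : nat).
Context (st : nat -> nat) (rg : nat -> nat -> nat) (R : run p m T st rg).

Local Notation J := (sorts m).
Local Notation Q := (length p).
Local Notation vM := (var_M).
Local Notation vS := (var_S m).
Local Notation v0 := (var_0 m p).
Local Notation vX := (var_X m p).
Local Notation vY := (var_Y m p).
Local Notation vU := (var_U m p).
Local Notation vZ := (var_Z m p).

(** Sort 2 sees tokens of strictly earlier rows, but sort 0 and the registers up to its own row.
    This difference is what later ties an order vertex to its own time. *)
Definition arc (a b : vertex) : Prop :=
  match a, b with
  | VM j, VX j' _ => j = j'
  | VS q, VX j t => j = 0 /\ st t = q
  | VX j t, VX j' s =>
      (j = 0 /\ (j' = 1 \/ 3 <= j') /\ s = t) \/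
      (j = 2 /\ j' = 1 /\ s < t) \/
      (j = 2 /\ (j' = 0 \/ 3 <= j') /\ s <= t) \/
      (3 <= j /\ j' = 1 /\ s < rg t (j - 3))
  | _, _ => False
  end.

Definition edge (a b : vertex) : Prop := arc a b \/ arc b a.

Definition dom (t : nat) (a : vertex) : Prop :=
  match a with
  | VM j => j < J
  | VS q => q <= Q
  | VX j s => j < J /\ s <= t
  end.

Lemma row_adj_spec i j : row_adj i j = true <->
  (i = 0 /\ (j = 1 \/ 3 <= j)) \/ (i = 2 /\ (j = 0 \/ 3 <= j)) \/
  (j = 0 /\ (i = 1 \/ 3 <= i)) \/ (j = 2 /\ (i = 0 \/ 3 <= i)).
Proof.
  unfold row_adj. rewrite !orb_true_iff, !andb_true_iff, !orb_true_iff,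
    !Nat.eqb_eq, !Nat.leb_le. tauto.
Qed.

(** The pattern is the same at all times because a register, being at most [t], does not contain the
    token of row [t]. *)
Lemma edge_row i j t : t <= T -> edge (VX i t) (VX j t) <-> row_adj i j = true.
Proof.
  intro Ht. rewrite row_adj_spec. unfold edge; simpl.
  pose proof (run_rg_le _ _ _ _ _ R t (i - 3) Ht).
  pose proof (run_rg_le _ _ _ _ _ R t (j - 3) Ht). lia.
Qed.

Lemma edge_register i t s : edge (VX 1 s) (VX (3 + i) t) <-> s < rg t i.
Proof.
  unfold edge, arc. replace (3 + i - 3) with i by lia.
  generalize (rg s (1 - 3)). lia.
Qed.

Lemma edge_order s t : edge (VX 1 s) (VX 2 t) <-> s < t.
Proof. unfold edge, arc. generalize (rg s (1 - 3)) (rg t (2 - 3)). lia. Qed.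

Lemma st_le t : t <= T -> st t <= Q.
Proof.
  intro H. destruct (Nat.eq_dec t T) as [->|].
  - now rewrite (run_halt _ _ _ _ _ R).
  - pose proof (run_live _ _ _ _ _ R t). lia.
Qed.

Lemma run_effect t : t < T ->
  match nth (st t) p (INC 0 0) with
  | INC x j => x < m /\ st (S t) = j /\ rg (S t) x = S (rg t x) /\
      forall y, y <> x -> rg (S t) y = rg t y
  | DEC x j1 j2 => x < m /\
      ((rg t x = 0 /\ st (S t) = j1 /\ forall y, rg (S t) y = rg t y) \/
       (rg t x = S (rg (S t) x) /\ st (S t) = j2 /\
        forall y, y <> x -> rg (S t) y = rg t y))
  end.
Proof.
  intro Ht. pose proof (run_live _ _ _ _ _ R t Ht) as Hl.
  pose proof (run_step _ _ _ _ _ R t Ht) as E. unfold machine_step in E.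
  assert (Hn : nth_error p (st t) = Some (nth (st t) p (INC 0 0)))
    by now apply nth_error_nth'.
  pose proof (run_regs _ _ _ _ _ R _ _ Hn) as Hok. rewrite Hn in E.
  destruct (nth (st t) p (INC 0 0)) as [x j|x j1 j2]; simpl in Hok.
  - injection E as -> ->. split; [tauto|]. split; [reflexivity|]. split.
    + apply upd_same.
    + intros; now apply upd_other.
  - split; [tauto|]. destruct (rg t x) eqn:Ex; injection E as -> ->.
    + left. auto.
    + right. rewrite upd_same. split; auto. split; auto. intros; now apply upd_other.
Qed.

Record embeds (K : graph) (phi : vertex -> V K) (t : nat) : Prop := {
  embeds_adj : forall a b, dom t a -> dom t b -> (adj K (phi a) (phi b) <-> edge a b);
  embeds_inj : forall a b, dom t a -> dom t b -> phi a = phi b -> a = b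
}.

(* [upto] for the image of row [t], which no vertex outside the image of [dom t]
   may satisfy. *)
Definition closed_at (K : graph) (phi : vertex -> V K) (t : nat) : Prop := forall w,
  (exists j, j < J /\ w = phi (VX j t)) \/
  (adj K w (phi (VX 2 t)) /\ w <> phi (VM 2)) \/
  (adj K w (phi (VM 2)) /\ ~ adj K w (phi (VX 0 t))) ->
  exists a, dom t a /\ w = phi a.

Ltac unfold_vars :=
  unfold var_M, var_S, var_0, var_X, var_Y, var_U, var_Z.
Ltac unfold_vars_in H :=
  unfold var_M, var_S, var_0, var_X, var_Y, var_U, var_Z in H.

Lemma sorts_ge : 3 <= J.
Proof. unfold sorts; lia. Qed.

Section Embedded.

Context (K : graph) (phi : vertex -> V K) (t : nat) (E : embeds K phi t) (HtT : t <= T).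
Context (e : nat -> V K).
Context (eM : forall j, j < J -> e (vM j) = phi (VM j)).
Context (eS : forall q, q <= Q -> e (vS q) = phi (VS q)).

Definition at_row (f : nat -> nat) (s : nat) : Prop :=
  forall j, j < J -> e (f j) = phi (VX j s).

Ltac dom_tac := pose proof sorts_ge; simpl; unfold sorts in *; lia.
Ltac adj_tac :=
  rewrite (embeds_adj _ _ _ E) by dom_tac.

Lemma row_intro f s : s <= t -> at_row f s -> sat K e (row m p f).
Proof.
  intros Hs Hf. apply sat_row. split; [|split].
  - intros i j Hi Hj. rewrite Hf, eM by auto. adj_tac. unfold edge; simpl. lia.
  - intros i j Hi Hj. rewrite !Hf by auto. adj_tac. apply edge_row; lia.
  - intros i q Hi Hq. rewrite Hf, eS by lia. adj_tac. unfold edge; simpl. lia.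
Qed.

(** The markers give the sorts. Sort 0 sees only the token and the registers of its own time [s0],
    so these agree in time. An order vertex of time [s] sees that sort 0 vertex iff [s0 <= s], and
    that token iff [s0 < s]; [row_adj] demands the former and forbids the latter, hence [s = s0]. *)
Lemma row_elim f : (forall j, j < J -> exists a, dom t a /\ e (f j) = phi a) ->
  sat K e (row m p f) -> exists s, s <= t /\ at_row f s.
Proof.
  intros Hd Hr. apply sat_row in Hr as (H1 & H2 & _).
  assert (H : forall j, j < J -> exists s, s <= t /\ e (f j) = phi (VX j s)).
  { intros j Hj. destruct (Hd j Hj) as (a & Ha & Hfa).
    pose proof (H1 j j Hj Hj) as H. rewrite Hfa, eM in H by auto.
    rewrite (embeds_adj _ _ _ E) in H by (auto; simpl; auto).
    destruct a as [i|q|i s]; unfold edge in H; simpl in *; try tauto.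
    exists s. split; [tauto|]. rewrite Hfa. replace i with j by tauto. auto. }
  pose proof sorts_ge.
  destruct (H 0) as (s0 & L0 & F0); [lia|]. exists s0. split; auto.
  assert (H' : forall j, j < J -> j <> 2 -> e (f j) = phi (VX j s0)).
  { intros j Hj N. destruct (Nat.eq_dec j 0) as [->|N0]; auto.
    destruct (H j Hj) as (s & Ls & Fs).
    pose proof (H2 0 j ltac:(lia) Hj) as A. rewrite row_adj_spec, F0, Fs in A.
    rewrite (embeds_adj _ _ _ E) in A by dom_tac. unfold edge in A; simpl in A.
    replace s0 with s by lia. auto. }
  intros j Hj. destruct (Nat.eq_dec j 2) as [->|N]; auto.
  destruct (H 2 Hj) as (s & Ls & Fs).
  pose proof (H2 0 2 ltac:(lia) Hj) as A. pose proof (H2 1 2 ltac:(lia) Hj) as B.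
  rewrite row_adj_spec, H', Fs in A, B by lia.
  rewrite (embeds_adj _ _ _ E) in A, B by dom_tac.
  rewrite edge_order in B. unfold edge in A; simpl in A.
  replace s0 with s by lia. auto.
Qed.

Lemma state_iff f s q : s <= t -> at_row f s -> q <= Q ->
  adj K (e (f 0)) (e (vS q)) <-> st s = q.
Proof.
  intros Hs Hf Hq. pose proof sorts_ge. rewrite Hf, eS by lia. adj_tac.
  unfold edge; simpl. lia.
Qed.

Lemma upto_iff f s w a : s <= t -> at_row f s -> dom t a -> e w = phi a ->
  sat K e (upto m f w) <-> exists j r, j < J /\ r <= s /\ a = VX j r.
Proof.
  intros Hs Hf Ha Hw. pose proof sorts_ge. rewrite sat_upto, Hw, !eM, !Hf by lia.
  rewrite !(embeds_adj _ _ _ E) by (auto; dom_tac). split.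
  - intros [(j & Hj & Hx)|[[A B]|[A B]]].
    + rewrite Hf in Hx by auto. apply (embeds_inj _ _ _ E) in Hx; auto; [|dom_tac].
      subst; eauto.
    (* The only marker seen by an order vertex is that of its own sort, which [upto] excludes. *)
    + destruct a as [i|q|i r]; unfold edge in A; simpl in A, Ha.
      * exfalso. apply B. f_equal. f_equal. lia.
      * lia.
      * pose proof (run_rg_le _ _ _ _ _ R s (i - 3)). exists i, r. repeat split; lia.
    + destruct a as [i|q|i r]; unfold edge in A, B; simpl in A, B, Ha; try lia.
      exists i, r. repeat split; lia.
  - intros (j & r & Hj & Hr & ->).
    destruct (Nat.eq_dec r s) as [->|Nr].
    { left. exists j. rewrite Hf; auto. }
    right. destruct (Nat.eq_dec j 2) as [->|Nj].
    + right. unfold edge; simpl. lia.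
    + left. split; [|intro Hx; apply (embeds_inj _ _ _ E) in Hx; [discriminate|dom_tac|dom_tac]].
      unfold edge; simpl. lia.
Qed.

(** The adjacencies of a new row to the old ones, in the form in which [next_row] prescribes them.
    An old register vertex cannot see the new token, since its value is at most its own time. *)
Lemma edge_next i j r s : i < J -> j < J -> r <= s -> s < T ->
  edge (VX i r) (VX j (S s)) <->
  (j = 2 /\ i <> 2) \/ (3 <= j /\ i = 1 /\ r < rg (S s) (j - 3)).
Proof.
  intros Hi Hj Hr Hs.
  pose proof (run_rg_le _ _ _ _ _ R r (i - 3) ltac:(lia)) as H.
  unfold edge, arc. split; [intros [X|X]|intros X];
    repeat match goal with Y : _ \/ _ |- _ => destruct Y | Y : _ /\ _ |- _ => destruct Y end;
    try subst i; try subst j; try lia.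
Qed.

Lemma token_iff s a : s <= t -> at_row vX s -> dom t a -> e vZ = phi a ->
  sat K e (token m p) <-> exists r, r <= s /\ a = VX 1 r.
Proof.
  intros Hs Hx Ha Hz. pose proof sorts_ge as HJ. unfold token. cbn [sat].
  rewrite (upto_iff vX s vZ a) by auto. rewrite Hz, eM by lia.
  rewrite (embeds_adj _ _ _ E) by (auto; dom_tac). split.
  - intros [(j & r & Hj & Hr & ->) A]. unfold edge in A; simpl in A.
    exists r. split; auto. f_equal. lia.
  - intros (r & Hr & ->). split; [exists 1, r; repeat split; lia|].
    unfold edge; simpl; auto.
Qed.

Lemma register_iff f s i r : s <= t -> at_row f s -> i < m -> r <= t ->
  e vZ = phi (VX 1 r) -> adj K (e vZ) (e (f (3 + i))) <-> r < rg s i.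
Proof.
  intros Hs Hf Hi Hr Hz. rewrite Hz, Hf by dom_tac. adj_tac. apply edge_register.
Qed.

Lemma below_u_iff v r : v <= t -> at_row vU v -> r <= t -> e vZ = phi (VX 1 r) ->
  sat K e (below_u m p) <-> r < v.
Proof.
  intros Hv Hu Hr Hz. pose proof sorts_ge as HJ. unfold below_u. cbn [sat].
  rewrite Hz, Hu by lia. adj_tac. apply edge_order.
Qed.

Lemma upto_u_iff v r : v <= t -> at_row vU v -> r <= t -> e vZ = phi (VX 1 r) ->
  sat K e (upto_u m p) <-> r <= v.
Proof.
  intros Hv Hu Hr Hz. pose proof sorts_ge as HJ. unfold upto_u. cbn [sat].
  rewrite Hz, !Hu by lia. adj_tac. rewrite edge_order.
  assert (H1 : phi (VX 1 r) = phi (VX 1 v) <-> r = v).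
  { split; [|now intros ->].
    intro H1; apply (embeds_inj _ _ _ E) in H1; [congruence|dom_tac|dom_tac]. }
  rewrite H1. lia.
Qed.

(* The row whose token is added to or removed from a register after time [s]. *)
Definition pivot (s : nat) : nat :=
  match nth (st s) p (INC 0 0) with
  | INC x _ => rg s x
  | DEC x _ _ => rg (S s) x
  end.

Lemma pivot_le s : s < T -> pivot s <= s.
Proof.
  intro Hs. unfold pivot. pose proof (run_effect s Hs) as H.
  destruct (nth (st s) p (INC 0 0)) as [x j|x j1 j2];
    pose proof (run_rg_le _ _ _ _ _ R s x ltac:(lia)); [lia|].
  destruct H as (_ & [(H1 & _ & H2)|(H1 & _)]); [rewrite H2|]; lia.
Qed.

Lemma update_intro s a x A : S s <= t -> at_row vX s -> at_row vY (S s) ->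
  dom t a -> e vZ = phi a -> (forall y, y <> x -> rg (S s) y = rg s y) ->
  (forall r, r <= s -> a = VX 1 r -> x < m -> sat K e A) ->
  sat K e (FImp (token m p) (update m p x A)).
Proof.
  intros Hs Hx Hy Ha Hz Hk HA. cbn [sat]. intro Ht.
  apply (token_iff s a) in Ht as (r & Hr & ->); auto; [|lia].
  apply sat_update. intros i Hi. destruct (Nat.eqb_spec i x) as [->|N].
  - now apply (HA r).
  - rewrite (register_iff vY (S s) i r), (register_iff vX s i r) by (auto; lia).
    now rewrite Hk.
Qed.

Lemma effect_intro s a : S s <= t -> s < T ->
  at_row v0 0 -> at_row vX s -> at_row vY (S s) -> at_row vU (pivot s) ->
  dom t a -> e vZ = phi a -> sat K e (effect m p (nth (st s) p (INC 0 0))).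
Proof.
  intros Hs HsT H0 Hx Hy Hu Ha Hz.
  pose proof (run_effect s HsT) as H. pose proof (pivot_le s HsT) as Hv.
  assert (Hstate : forall q, st (S s) = q -> sat K e (state m p vY q)).
  { intros q <-. apply sat_state. intros q Hq.
    rewrite (state_iff vY (S s) q) by auto. split; auto. }
  unfold pivot in *.
  destruct (nth (st s) p (INC 0 0)) as [x j|x j1 j2]; cbn [effect sat]; unfold change.
  - destruct H as (Hxm & H1 & H2 & H3). split; [auto|].
    apply (update_intro s a); auto. intros r Hr -> _. cbn [sat]. split.
    + rewrite (register_iff vX s x r) by (auto; lia).
      rewrite (below_u_iff (rg s x) r) by (auto; lia). lia.
    + rewrite (register_iff vY (S s) x r) by (auto; lia).
      rewrite (upto_u_iff (rg s x) r) by (auto; lia). lia.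
  - destruct H as (Hxm & H). pose proof sorts_ge as HJ.
    assert (Hzero : adj K (e (vX (3 + x))) (e (v0 1)) <-> 0 < rg s x).
    { rewrite Hx, H0 by dom_tac. adj_tac.
      rewrite <- edge_register. unfold edge. tauto. }
    split; intro Hz0.
    + destruct H as [(H1 & H2 & H3)|(H1 & _)]; [|rewrite Hzero in Hz0; lia].
      split; [auto|]. apply (update_intro s a); auto. intros; reflexivity.
    + apply Hzero in Hz0. destruct H as [(H1 & _)|(H1 & H2 & H3)]; [lia|].
      split; [auto|]. apply (update_intro s a); auto. intros r Hr -> _. cbn [sat]. split.
      * rewrite (register_iff vX s x r) by (auto; lia).
        rewrite (upto_u_iff (rg (S s) x) r) by (auto; lia). lia.
      * rewrite (register_iff vY (S s) x r) by (auto; lia).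
        rewrite (below_u_iff (rg (S s) x) r) by (auto; lia). lia.
Qed.

Lemma next_row_intro s a : S s <= t -> s < T ->
  at_row v0 0 -> at_row vX s -> at_row vY (S s) -> at_row vU (pivot s) ->
  dom t a -> e vZ = phi a -> sat K e (next_row m p).
Proof.
  intros Hs HsT H0 Hx Hy Hu Ha Hz. pose proof sorts_ge as HJ.
  pose proof (pivot_le s HsT) as Hv. unfold next_row. cbn [sat].
  split; [|split; [|split; [|split; [|split; [|split]]]]].
  - apply (row_intro vY (S s)); auto.
  - apply (row_intro vU (pivot s)); auto; lia.
  - apply sat_conjn. intros j Hj.
    apply (upto_iff vX s _ (VX j (pivot s))); auto; try dom_tac.
    exists j, (pivot s); auto.
  - apply sat_conjn. intros j Hj. cbn [sat].
    rewrite (upto_iff vX s _ (VX j (S s))); auto; try dom_tac.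
    intros (i & r & _ & Hr & X). injection X as -> <-. lia.
  - rewrite (upto_iff vY (S s) _ a), (upto_iff vX s _ a), sat_in_row by (auto; lia).
    intros (j & r & Hj & Hr & ->). destruct (Nat.eq_dec r (S s)) as [->|N].
    + right. exists j. split; auto. rewrite Hz, Hy; auto.
    + left. exists j, r. repeat split; auto; lia.
  - rewrite (upto_iff vX s _ a) by (auto; lia). intros (i & r & Hi & Hr & ->).
    assert (L : forall j, j < J -> adj K (e vZ) (e (vY j)) <->
      (j = 2 /\ i <> 2) \/ (3 <= j /\ i = 1 /\ r < rg (S s) (j - 3))).
    { intros j Hj. rewrite Hz, Hy by auto. adj_tac. apply edge_next; auto. }
    assert (L' : forall j, j < J -> adj K (e vZ) (e (vM j)) <-> i = j).
    { intros j Hj. rewrite Hz, eM by auto. adj_tac. unfold edge; simpl.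
      intuition auto. }
    rewrite !L, !L' by lia. split; [|split; [|split]]; try lia.
    intro Hi1. apply sat_conjn. intros k Hk. cbn [sat]. rewrite (L (3 + k)) by dom_tac. lia.
  - apply sat_conjn. intros q Hq. cbn [sat]. rewrite (state_iff vX s) by (auto; lia).
    intros <-. now apply (effect_intro s a).
Qed.

Lemma init_intro a : at_row v0 0 -> dom t a -> e vZ = phi a -> sat K e (init m p).
Proof.
  intros H0 Ha Hz. pose proof sorts_ge as HJ. unfold init. cbn [sat].
  assert (Hne : forall b c, dom t b -> dom t c -> b <> c -> phi b <> phi c).
  { intros b c Hb Hc N X. now apply (embeds_inj _ _ _ E) in X. }
  split; [|split; [|split; [|split; [|split]]]].
  - apply sat_conjn; intros i Hi. apply sat_conjn; intros j Hj. cbn [sat].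
    rewrite sat_lit, Nat.eqb_eq. cbn [sat]. rewrite !eM by auto. adj_tac. split.
    + split; [|now intros ->]. intro X. apply (embeds_inj _ _ _ E) in X; auto. congruence.
    + unfold edge; simpl; tauto.
  - apply sat_conjn; intros i Hi. apply sat_conjn; intros q Hq. cbn [sat].
    rewrite !eM, !eS by lia. adj_tac. split.
    + apply Hne; [dom_tac|dom_tac|discriminate].
    + unfold edge; simpl; tauto.
  - apply sat_conjn; intros i Hi. apply sat_conjn; intros j Hj. cbn [sat].
    rewrite sat_lit, Nat.eqb_eq. cbn [sat]. rewrite !eS by lia. adj_tac. split.
    + split; [|now intros ->]. intro X.
      apply (embeds_inj _ _ _ E) in X; [congruence|dom_tac|dom_tac].
    + unfold edge; simpl; tauto.
  - apply (row_intro v0 0); auto; lia.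
  - apply sat_state. intros q Hq. rewrite (state_iff v0 0 q) by (auto; lia).
    rewrite (run_init_st _ _ _ _ _ R). split; auto.
  - rewrite (upto_iff v0 0 _ a), sat_in_row by (auto; lia).
    intros (j & r & Hj & Hr & ->). exists j. split; auto.
    rewrite Hz, H0 by auto. f_equal. f_equal. lia.
Qed.

(** * Models of the sentence *)

(** In an arbitrary model [w] may be foreign, and [upto_iff] says nothing about it; closedness first
    brings it into the image. *)
Lemma upto_old f w : closed_at K phi t -> at_row f t -> sat K e (upto m f w) ->
  exists a, dom t a /\ e w = phi a.
Proof.
  intros Hc Hf Hw. pose proof sorts_ge as HJ. apply Hc. apply sat_upto in Hw.
  rewrite !eM, !Hf in Hw by lia. destruct Hw as [(j & Hj & Hw)|Hw]; auto.
  left. exists j. now rewrite Hw, Hf.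
Qed.

Lemma change_elim x A B r : sat K e (change m p x A B) ->
  at_row vX t -> e vZ = phi (VX 1 r) -> r <= t -> forall i, i < m ->
    if i =? x then (r < rg t x <-> sat K e A) /\ (adj K (e vZ) (e (vY (3 + i))) <-> sat K e B)
    else (adj K (e vZ) (e (vY (3 + i))) <-> r < rg t i).
Proof.
  intros Hc Hx Hz Hr i Hi. unfold change in Hc. cbn [sat] in Hc.
  pose proof sorts_ge as HJ.
  rewrite (token_iff t (VX 1 r)), sat_update in Hc by (auto; dom_tac).
  specialize (Hc (ex_intro _ r (conj Hr eq_refl)) i Hi).
  destruct (Nat.eqb_spec i x) as [Hix|N].
  - subst i. cbn [sat] in Hc. now rewrite (register_iff vX t x r) in Hc.
  - now rewrite (register_iff vX t i r) in Hc.
Qed.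

Lemma effect_state s : t < T -> s = st (S t) -> at_row v0 0 -> at_row vX t ->
  sat K e (effect m p (nth (st t) p (INC 0 0))) ->
  sat K e (state m p vY s).
Proof.
  intros Ht -> H0 Hx He. pose proof (run_effect t Ht) as H.
  pose proof sorts_ge as HJ.
  destruct (nth (st t) p (INC 0 0)) as [x j|x j1 j2]; cbn [effect sat] in He.
  - destruct H as (_ & -> & _). tauto.
  - destruct H as (Hxm & H).
    assert (Hzero : adj K (e (vX (3 + x))) (e (v0 1)) <-> 0 < rg t x).
    { rewrite Hx, H0 by dom_tac. adj_tac. rewrite <- edge_register. unfold edge. tauto. }
    rewrite Hzero in He. destruct H as [(H1 & -> & _)|(H1 & -> & _)].
    + apply He. lia.
    + apply He. lia.
Qed.

End Embedded.

(** Written as [sat] evaluates a quantifier over [var_Z], so that the two are convertible. *)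
Definition with_z {K : graph} (e : nat -> V K) (z : V K) : nat -> V K :=
  fun y => if Nat.eqb y vZ then z else e y.

Lemma with_z_lt {K : graph} (e : nat -> V K) z x : x < vZ -> with_z e z x = e x.
Proof. intro H. unfold with_z. now rewrite (proj2 (Nat.eqb_neq x vZ)) by lia. Qed.

Lemma with_z_eq {K : graph} (e : nat -> V K) z : with_z e z vZ = z.
Proof. unfold with_z. now rewrite Nat.eqb_refl. Qed.

Definition extend {K : graph} (phi : vertex -> V K) (t : nat) (y : nat -> V K)
  (a : vertex) : V K :=
  match a with VX j s => if s =? S t then y j else phi a | _ => phi a end.

Lemma dom_succ t a : dom (S t) a -> dom t a \/ exists j, j < J /\ a = VX j (S t).
Proof.
  destruct a as [i|q|i s]; simpl; auto. intros [Hi Hs].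
  destruct (Nat.eq_dec s (S t)) as [->|N]; [right; eauto|left; lia].
Qed.

Lemma extend_old K (phi : vertex -> V K) t y a : dom t a -> extend phi t y a = phi a.
Proof.
  destruct a as [i|q|i s]; simpl; auto. intros [_ Hs].
  now destruct (Nat.eqb_spec s (S t)); [lia|].
Qed.

Lemma extend_new K (phi : vertex -> V K) t y j : extend phi t y (VX j (S t)) = y j.
Proof. simpl. now rewrite Nat.eqb_refl. Qed.

Lemma embeds_extend K phi t y : embeds K phi t ->
  (forall j a, j < J -> dom t a ->
     (adj K (phi a) (y j) <-> edge a (VX j (S t))) /\ y j <> phi a) ->
  (forall i j, i < J -> j < J ->
     (adj K (y i) (y j) <-> edge (VX i (S t)) (VX j (S t))) /\ (y i = y j -> i = j)) ->
  embeds K (extend phi t y) (S t).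
Proof.
  intros E Hold Hnew. split; intros a b Ha Hb;
    apply dom_succ in Ha as [Ha|(i & Hi & ->)]; apply dom_succ in Hb as [Hb|(j & Hj & ->)];
    rewrite ?extend_new, ?(extend_old _ _ _ _ _ Ha), ?(extend_old _ _ _ _ _ Hb).
  - now apply (embeds_adj _ _ _ E).
  - now apply Hold.
  - destruct (Hold i b Hi Hb) as [H _]. unfold edge in *.
    split; intro X.
    + apply adj_sym in X. tauto.
    + apply adj_sym. tauto.
  - now apply Hnew.
  - now apply (embeds_inj _ _ _ E).
  - intro X. symmetry in X. now apply Hold in X.
  - intro X. now apply Hold in X.
  - intro X. apply Hnew in X; congruence.
Qed.

(** The induction step of the reconstruction. Most contacts of [Y] are dictated directly by
    [next_row]; for the register that changes, [U] has to be identified first. *)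
Lemma next_row_elim K phi t e : embeds K phi t -> closed_at K phi t -> t < T ->
  (forall j, j < J -> e (vM j) = phi (VM j)) ->
  (forall q, q <= Q -> e (vS q) = phi (VS q)) ->
  at_row K phi e v0 0 -> at_row K phi e vX t ->
  (forall z, sat K (with_z e z) (next_row m p)) ->
  embeds K (extend phi t (fun j => e (vY j))) (S t) /\
  closed_at K (extend phi t (fun j => e (vY j))) (S t).
Proof.
  intros E Hcl Ht eM eS H0 Hx HN. pose proof sorts_ge as HJ.
  assert (Ht' : t <= T) by lia.
  assert (zM : forall z j, j < J -> with_z e z (vM j) = phi (VM j)).
  { intros z j Hj. rewrite with_z_lt; [auto|unfold_vars; lia]. }
  assert (zS : forall z q, q <= Q -> with_z e z (vS q) = phi (VS q)).
  { intros z q Hq. rewrite with_z_lt; [auto|unfold_vars; lia]. }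
  assert (z0 : forall z, at_row K phi (with_z e z) v0 0).
  { intros z j Hj. rewrite with_z_lt; [auto|unfold_vars; lia]. }
  assert (zX : forall z, at_row K phi (with_z e z) vX t).
  { intros z j Hj. rewrite with_z_lt; [auto|unfold_vars; lia]. }
  assert (zY : forall z j, j < J -> with_z e z (vY j) = e (vY j)).
  { intros z j Hj. rewrite with_z_lt; [auto|unfold_vars; lia]. }
  assert (zU : forall z j, j < J -> with_z e z (vU j) = e (vU j)).
  { intros z j Hj. rewrite with_z_lt; [auto|unfold_vars; lia]. }
  unfold next_row in HN. cbn [sat] in HN.
  set (y := fun j => e (vY j)) in *.
  (* All of [U] is old, hence in the image, hence by [row_elim] a row of one time [v]. Any value of
     [Z] serves here, since [U] is chosen before it. *)
  assert (HU : exists v, v <= t /\ forall z, at_row K phi (with_z e z) vU v).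
  { set (z := e 0). destruct (HN z) as (_ & Hr & Ho & _).
    rewrite sat_conjn in Ho.
    destruct (row_elim K phi t E Ht' (with_z e z) (zM z) vU) as (v & Hv & Hu); auto.
    - intros j Hj.
      destruct (upto_old K phi t Ht' (with_z e z) (zM z) vX (vU j) Hcl (zX z) (Ho j Hj))
        as (a & Ha & Hja); eauto.
    - exists v. split; auto. intros z' j Hj. rewrite zU by auto.
      rewrite <- (zU z j Hj). now apply Hu. }
  destruct HU as (v & Hv & zVU).
  destruct (HN (e 0)) as (HrY & _ & _ & Hfresh & _ & _ & Hst).
  set (z := e 0) in *.
  apply sat_row in HrY as (Y1 & Y2 & Y3).
  assert (Y1' : forall i j, i < J -> j < J -> (adj K (y i) (phi (VM j)) <-> i = j)).
  { intros i j Hi Hj. unfold y. rewrite <- (zM z j Hj), <- (zY z i Hi). now apply Y1. }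
  assert (Y2' : forall i j, i < J -> j < J -> (adj K (y i) (y j) <-> row_adj i j = true)).
  { intros i j Hi Hj. unfold y. rewrite <- (zY z j Hj), <- (zY z i Hi). now apply Y2. }
  assert (Y3' : forall i q, 0 < i < J -> q <= Q -> ~ adj K (y i) (phi (VS q))).
  { intros i q Hi Hq. unfold y. rewrite <- (zS z q Hq), <- (zY z i) by lia. now apply Y3. }
  assert (HE : forall z, sat K (with_z e z) (effect m p (nth (st t) p (INC 0 0)))).
  { intro w. destruct (HN w) as (_ & _ & _ & _ & _ & _ & H).
    rewrite sat_conjn in H. specialize (H (st t)). cbn [sat] in H. apply H.
    - now apply (run_live _ _ _ _ _ R).
    - apply (state_iff K phi t E Ht' (with_z e w) (zS w) vX t); auto.
      now apply st_le. }
  assert (YS : forall q, q <= Q -> (adj K (y 0) (phi (VS q)) <-> st (S t) = q)).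
  { intros q Hq. pose proof (HE z) as H.
    apply (effect_state K phi t E Ht' (with_z e z) (st (S t))) in H; auto.
    rewrite sat_state in H. specialize (H q Hq). rewrite zY, zS in H by lia.
    unfold y. rewrite H. split; auto. }
  assert (HC : forall x A B, (forall z, sat K (with_z e z) (change m p x A B)) ->
    forall i r, i < m -> r <= t ->
    if i =? x
    then (r < rg t x <-> sat K (with_z e (phi (VX 1 r))) A) /\
         (adj K (phi (VX 1 r)) (y (3 + i)) <-> sat K (with_z e (phi (VX 1 r))) B)
    else (adj K (phi (VX 1 r)) (y (3 + i)) <-> r < rg t i)).
  { intros x A B H i r Hi Hr. set (w := phi (VX 1 r)).
    pose proof (change_elim K phi t E Ht' (with_z e w) (zM w) x A B r (H w) (zX w)
                  (with_z_eq e w) Hr i Hi) as C.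
    rewrite with_z_eq, zY in C by (unfold sorts; lia). exact C. }
  assert (Hbelow : forall r, r <= t ->
    sat K (with_z e (phi (VX 1 r))) (below_u m p) <-> r < v).
  { intros r Hr. apply (below_u_iff K phi t E Ht'); auto. apply with_z_eq. }
  assert (Hupto : forall r, r <= t ->
    sat K (with_z e (phi (VX 1 r))) (upto_u m p) <-> r <= v).
  { intros r Hr. apply (upto_u_iff K phi t E Ht'); auto. apply with_z_eq. }
  assert (Yreg : forall i r, i < m -> r <= t ->
    adj K (phi (VX 1 r)) (y (3 + i)) <-> r < rg (S t) i).
  { pose proof (run_effect t Ht) as H.
    destruct (nth (st t) p (INC 0 0)) as [x j|x j1 j2]; cbn [effect sat] in HE.
    - destruct H as (Hxm & _ & H2 & H3).
      pose proof (HC x _ _ (fun w => proj2 (HE w))) as C.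
      (* The old value must be the set of tokens before [v]. Testing the tokens of the rows [v] and
         [rg t x], both existing, excludes either strict inequality. *)
      assert (Hpin : v = rg t x).
      { pose proof (run_rg_le _ _ _ _ _ R t x Ht') as Hle.
        pose proof (C x v Hxm Hv) as C1. pose proof (C x (rg t x) Hxm Hle) as C2.
        rewrite Nat.eqb_refl, Hbelow in C1, C2 by auto. lia. }
      intros i r Hi Hr. specialize (C i r Hi Hr).
      destruct (Nat.eqb_spec i x) as [Hix|N].
      + subst i. rewrite Hupto in C by auto. destruct C as [_ ->]. lia.
      + rewrite H3; auto.
    - destruct H as (Hxm & H).
      assert (Hzero : forall w, adj K (with_z e w (vX (3 + x))) (with_z e w (v0 1)) <->
                                0 < rg t x).
      { intro w. rewrite zX, z0 by (unfold sorts in *; lia).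
        rewrite (embeds_adj _ _ _ E) by (simpl; unfold sorts in *; lia).
        rewrite <- edge_register. unfold edge. tauto. }
      destruct H as [(H1 & _ & H3)|(H1 & _ & H3)].
      + intros i r Hi Hr. set (w := phi (VX 1 r)). destruct (HE w) as [Hz _].
        rewrite Hzero in Hz. destruct Hz as [_ Hz]; [lia|].
        rewrite (token_iff K phi t E Ht' (with_z e w) (zM w) t (VX 1 r)) in Hz; auto;
          [|simpl; lia|apply with_z_eq].
        specialize (Hz (ex_intro _ r (conj Hr eq_refl))).
        rewrite sat_update in Hz. specialize (Hz i Hi).
        replace (i =? m) with false in Hz by (symmetry; apply Nat.eqb_neq; lia).
        rewrite (register_iff K phi t E Ht' (with_z e w) vX t i r) in Hz; auto;
          [|apply with_z_eq].
        rewrite with_z_eq, zY in Hz by (unfold sorts; lia). rewrite H3. exact Hz.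
      + assert (C0 : forall w, sat K (with_z e w) (change m p x (upto_u m p) (below_u m p))).
        { intro w. destruct (HE w) as [_ Hz]. rewrite Hzero in Hz. apply Hz. lia. }
        pose proof (HC x _ _ C0) as C.
        (* Here the old value must be the set of tokens up to [v]. The token of row [v] shows that
           [v] is below the value, and that of row [S v], if still below it, gives a
           contradiction. *)
        assert (Hpin : v = rg (S t) x).
        { pose proof (run_rg_le _ _ _ _ _ R t x Ht') as Hle.
          pose proof (C x v Hxm Hv) as C1.
          pose proof (C x (rg (S t) x) Hxm ltac:(lia)) as C2.
          destruct (Nat.eq_dec (S v) (rg t x)) as [|N]; [lia|].
          assert (v < rg t x) by (rewrite Nat.eqb_refl, Hupto in C1 by auto; lia).
          pose proof (C x (S v) Hxm ltac:(lia)) as C3.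
          rewrite Nat.eqb_refl, Hupto in C3 by lia. lia. }
        intros i r Hi Hr. specialize (C i r Hi Hr).
        destruct (Nat.eqb_spec i x) as [Hix|N].
        * subst i. rewrite Hbelow in C by auto. destruct C as [_ ->]. lia.
        * rewrite H3; auto. }
  assert (Yold : forall j i r, j < J -> i < J -> r <= t ->
    (adj K (phi (VX i r)) (y j) <-> edge (VX i r) (VX j (S t))) /\ y j <> phi (VX i r)).
  { intros j i r Hj Hi Hr. split.
    - rewrite edge_next by auto. set (w := phi (VX i r)).
      destruct (HN w) as (_ & _ & _ & _ & _ & H & _).
      rewrite (upto_iff K phi t E Ht' (with_z e w) (zM w) vX t _ (VX i r)) in H; auto;
        [|simpl; auto|apply with_z_eq].
      destruct H as (N0 & N1 & N2 & N3); [exists i, r; auto|].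
      rewrite with_z_eq in N0, N1, N2, N3. rewrite sat_conjn in N3.
      rewrite zM in N2, N3 by lia. rewrite zY in N0, N1, N2 by lia.
      assert (L : forall k, k < J -> adj K w (phi (VM k)) <-> i = k).
      { intros k Hk. unfold w. rewrite (embeds_adj _ _ _ E) by (simpl; lia).
        unfold edge; simpl. intuition auto. }
      rewrite L in N2, N3 by lia.
      destruct j as [|[|[|k]]].
      + split; [tauto|lia].
      + split; [tauto|lia].
      + unfold y. rewrite N2. lia.
      + assert (Hk : k < m) by (unfold sorts in Hj; lia).
        change (S (S (S k))) with (3 + k) in *.
        replace (3 + k - 3) with k by lia.
        destruct (Nat.eq_dec i 1) as [Hi1|Hi1].
        * unfold w. subst i. rewrite Yreg by auto. lia.
        * specialize (N3 Hi1 k Hk). cbn [sat] in N3. rewrite with_z_eq, zY in N3 by auto.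
          split; [tauto|lia].
    - intro X. rewrite sat_conjn in Hfresh. apply (Hfresh j Hj).
      apply (upto_iff K phi t E Ht' (with_z e z) (zM z) vX t _ (VX i r)); auto.
      + simpl; auto.
      + rewrite zY; auto.
      + exists i, r; auto. }
  assert (E' : embeds K (extend phi t y) (S t)).
  { apply embeds_extend; auto.
    - intros j [i|q|i r] Hj Ha; simpl in Ha.
      + split.
        * transitivity (j = i); [rewrite <- Y1' by auto; split; apply adj_sym|].
          unfold edge; simpl. intuition auto.
        (* A row vertex sees the marker of its sort, whereas no two markers are adjacent; hence it
           is not a marker. *)
        * intro X. assert (A : adj K (y j) (phi (VM j))) by now apply Y1'.
          rewrite X in A. apply (embeds_adj _ _ _ E) in A; [|simpl; lia|simpl; lia].
          unfold edge in A; simpl in A. tauto.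
      + split.
        * transitivity (j = 0 /\ st (S t) = q); [|unfold edge; simpl; intuition auto].
          destruct (Nat.eq_dec j 0) as [->|N].
          -- rewrite <- (YS q Ha) at 1. split; [intro A; split; auto|intros [_ A]];
               now apply adj_sym.
          -- split; [|tauto]. intro A. apply adj_sym in A. apply Y3' in A; [tauto|lia|auto].
        * intro X. assert (A : adj K (y j) (phi (VM j))) by now apply Y1'.
          rewrite X in A. apply (embeds_adj _ _ _ E) in A; [|simpl; lia|simpl; lia].
          unfold edge in A; simpl in A. tauto.
      + apply Yold; tauto.
    - intros i j Hi Hj. split.
      + rewrite Y2' by auto. symmetry. now apply edge_row.
      + intro X. assert (H : adj K (y j) (phi (VM i))) by (rewrite <- X; now apply Y1').
        apply Y1' in H; auto. }
  split; [exact E'|].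
  intros w Hw.
  (* Closedness at [S t]: the clause on [upto] in [next_row] sends [w] either into the old part,
     where closedness at [t] applies, or into the new row. *)
  assert (HwY : sat K (with_z e w) (upto m vY vZ)).
  { apply sat_upto. rewrite with_z_eq, zM, !zY by lia.
    rewrite !extend_new, extend_old in Hw by (simpl; lia).
    destruct Hw as [(j & Hj & Hw)|Hw]; [left; exists j|right; exact Hw].
    rewrite extend_new in Hw. rewrite zY; auto. }
  destruct (HN w) as (_ & _ & _ & _ & H & _).
  destruct (H HwY) as [Ho|Hn].
  - apply (upto_old K phi t Ht' (with_z e w) (zM w) vX vZ Hcl (zX w)) in Ho as (a & Ha & Hwa).
    rewrite with_z_eq in Hwa. exists a. split.
    + destruct a; simpl in *; auto. lia.
    + now rewrite extend_old.
  - apply sat_in_row in Hn as (j & Hj & Hn). rewrite with_z_eq, zY in Hn by auto.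
    exists (VX j (S t)). split; [simpl; auto|]. now rewrite extend_new.
Qed.

Lemma init_elim K e : (forall z, sat K (with_z e z) (init m p)) ->
  exists phi, embeds K phi 0 /\ closed_at K phi 0 /\
    (forall j, j < J -> e (vM j) = phi (VM j)) /\
    (forall q, q <= Q -> e (vS q) = phi (VS q)) /\ at_row K phi e v0 0.
Proof.
  intro HN. pose proof sorts_ge as HJ.
  assert (zM : forall z j, j < J -> with_z e z (vM j) = e (vM j)).
  { intros z j Hj. apply with_z_lt. unfold_vars; lia. }
  assert (zS : forall z q, q <= Q -> with_z e z (vS q) = e (vS q)).
  { intros z q Hq. apply with_z_lt. unfold_vars; lia. }
  assert (z0 : forall z j, j < J -> with_z e z (v0 j) = e (v0 j)).
  { intros z j Hj. apply with_z_lt. unfold_vars; lia. }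
  unfold init in HN. cbn [sat] in HN.
  destruct (HN (e 0)) as (MM & MS & SS & HR & HS & _). set (z := e 0) in *.
  assert (MM' : forall i j, i < J -> j < J ->
    (e (vM i) = e (vM j) <-> i = j) /\ ~ adj K (e (vM i)) (e (vM j))).
  { intros i j Hi Hj. rewrite sat_conjn in MM. specialize (MM i Hi).
    rewrite sat_conjn in MM. specialize (MM j Hj). cbn [sat] in MM.
    rewrite sat_lit, Nat.eqb_eq in MM. cbn [sat] in MM. now rewrite !zM in MM. }
  assert (MS' : forall i q, i < J -> q <= Q ->
    e (vM i) <> e (vS q) /\ ~ adj K (e (vM i)) (e (vS q))).
  { intros i q Hi Hq. rewrite sat_conjn in MS. specialize (MS i Hi).
    rewrite sat_conjn in MS. specialize (MS q ltac:(lia)). cbn [sat] in MS.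
    now rewrite zM, zS in MS. }
  assert (SS' : forall q s, q <= Q -> s <= Q ->
    (e (vS q) = e (vS s) <-> q = s) /\ ~ adj K (e (vS q)) (e (vS s))).
  { intros i j Hi Hj. rewrite sat_conjn in SS. specialize (SS i ltac:(lia)).
    rewrite sat_conjn in SS. specialize (SS j ltac:(lia)). cbn [sat] in SS.
    rewrite sat_lit, Nat.eqb_eq in SS. cbn [sat] in SS. now rewrite !zS in SS. }
  apply sat_row in HR as (R1 & R2 & R3). rewrite sat_state in HS.
  assert (R1' : forall i j, i < J -> j < J -> (adj K (e (v0 i)) (e (vM j)) <-> i = j)).
  { intros i j Hi Hj. rewrite <- (zM z j Hj), <- (z0 z i Hi). now apply R1. }
  assert (R2' : forall i j, i < J -> j < J ->
    (adj K (e (v0 i)) (e (v0 j)) <-> row_adj i j = true)).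
  { intros i j Hi Hj. rewrite <- (z0 z i Hi), <- (z0 z j Hj). now apply R2. }
  assert (R3' : forall i q, i < J -> q <= Q ->
    (adj K (e (v0 i)) (e (vS q)) <-> i = 0 /\ q = 0)).
  { intros i q Hi Hq. rewrite <- (zS z q Hq), <- (z0 z i Hi).
    destruct (Nat.eq_dec i 0) as [->|N].
    - rewrite HS by auto. tauto.
    - split; [|tauto]. intro A. apply R3 in A; [tauto|lia|auto]. }
  (* The time is ignored, as [dom 0] contains row 0 only. *)
  set (phi a := match a with VM j => e (vM j) | VS q => e (vS q) | VX j _ => e (v0 j) end).
  exists phi. split; [|split; [|split; [|split]]]; try (intros j Hj; reflexivity).
  - pose proof (run_init_st _ _ _ _ _ R) as S0.
    assert (N0 : forall i a, i < J -> dom 0 a -> phi (VX i 0) = phi a -> a = VX i 0).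
    { intros i [j|q|j r] Hi Ha X; simpl in *.
      - assert (A : adj K (e (v0 i)) (e (vM i))) by now apply R1'.
        rewrite X in A. apply MM' in A; tauto.
      - assert (A : adj K (e (v0 i)) (e (vM i))) by now apply R1'.
        rewrite X in A. apply adj_sym in A. apply MS' in A; tauto.
      - assert (A : adj K (e (v0 i)) (e (vM i))) by now apply R1'.
        rewrite X in A. apply R1' in A; [|tauto|tauto]. f_equal; [auto|lia]. }
    split; intros a b Ha Hb.
    + destruct a as [i|q|i r]; destruct b as [j|s|j r']; simpl in Ha, Hb; simpl;
        try (replace r with 0 by lia); try (replace r' with 0 by lia).
      * unfold edge; simpl. split; [|tauto]. intro A. apply MM' in A; tauto.
      * unfold edge; simpl. split; [|tauto]. intro A. apply MS' in A; tauto.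
      * transitivity (j = i); [|unfold edge; simpl; intuition auto].
        rewrite <- R1' by tauto. split; apply adj_sym.
      * unfold edge; simpl. split; [|tauto]. intro A. apply adj_sym in A.
        apply MS' in A; tauto.
      * unfold edge; simpl. split; [|tauto]. intro A. apply SS' in A; tauto.
      * transitivity (j = 0 /\ q = 0); [|unfold edge; simpl; lia].
        rewrite <- R3' by tauto. split; apply adj_sym.
      * rewrite R1' by tauto. unfold edge; simpl. intuition auto.
      * rewrite R3' by tauto. unfold edge; simpl. lia.
      * rewrite R2' by tauto. symmetry. apply edge_row. lia.
    + destruct a as [i|q|i r]; [| |replace r with 0 by (simpl in Ha; lia);
        intro X; symmetry; apply N0; simpl in *; auto; tauto];
      (destruct b as [j|s|j r']; [| |replace r' with 0 by (simpl in Hb; lia);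
        intro X; apply N0; simpl in *; auto; tauto]); simpl in *; intro X.
      * f_equal. now apply MM'.
      * apply MS' in X; tauto.
      * symmetry in X. apply MS' in X; tauto.
      * f_equal. now apply SS'.
  - intros w Hw. destruct (HN w) as (_ & _ & _ & _ & _ & H).
    rewrite sat_upto, sat_in_row in H.
    destruct H as (j & Hj & Hwj).
    + rewrite with_z_eq, zM, !z0 by lia. destruct Hw as [(j & Hj & Hw)|Hw]; auto.
      left. exists j. now rewrite z0.
    + exists (VX j 0). split; [simpl; auto|]. now rewrite with_z_eq, z0 in Hwj.
Qed.

Lemma sentence_elim K env : sat K env (sentence m p) ->
  exists phi, embeds K phi T /\ forall w, exists a, dom T a /\ w = phi a.
Proof.
  intro HA. pose proof sorts_ge as HJ.
  unfold sentence in HA. apply sat_exs in HA as (e1 & _ & HA).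
  rewrite sat_alls in HA.
  assert (HA' : forall e2, agree (J + S Q + J) J e1 e2 -> exists e3,
    agree (J + S Q + J + J) (J + J) e2 e3 /\ forall z, sat K (with_z e3 z) (body m p)).
  { intros e2 H. apply HA in H. apply sat_exs in H as (e3 & H3 & H). eauto. }
  clear HA.
  assert (Hinit : exists phi, embeds K phi 0 /\ closed_at K phi 0 /\
    (forall j, j < J -> e1 (vM j) = phi (VM j)) /\
    (forall q, q <= Q -> e1 (vS q) = phi (VS q)) /\ at_row K phi e1 v0 0).
  { destruct (HA' e1) as (e3 & H3 & H); [now intros x _|].
    destruct (init_elim K e3) as (phi & E & C & H1 & H2 & H4).
    { intro z. specialize (H z). unfold body in H. cbn [sat] in H. tauto. }
    exists phi. split; [|split; [|split; [|split]]]; auto.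
    - intros j Hj. rewrite <- H1, H3; auto. unfold_vars; lia.
    - intros j Hj. rewrite <- H2, H3; auto. unfold_vars; lia.
    - intros j Hj. rewrite <- H4, H3; auto. unfold_vars; lia. }
  assert (Hext : forall t phi, t <= T -> embeds K phi t ->
    (forall j, j < J -> e1 (vM j) = phi (VM j)) ->
    (forall q, q <= Q -> e1 (vS q) = phi (VS q)) -> at_row K phi e1 v0 0 ->
    exists e, (forall j, j < J -> e (vM j) = phi (VM j)) /\
      (forall q, q <= Q -> e (vS q) = phi (VS q)) /\ at_row K phi e v0 0 /\
      at_row K phi e vX t /\
      forall z, (adj K (with_z e z (vX 0)) (with_z e z (vS Q)) ->
           sat K (with_z e z) (marker m p vZ) \/ sat K (with_z e z) (upto m vX vZ)) /\
        (~ adj K (with_z e z (vX 0)) (with_z e z (vS Q)) ->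
           sat K (with_z e z) (next_row m p))).
  { intros t phi Ht E H1 H2 H3.
    set (c := J + S Q + J).
    (* The universal block [X] is instantiated with the copy of row [t]; the second existential
       block then supplies [Y] and [U]. *)
    set (e2 := fun x => if (c <=? x) && (x <? c + J) then phi (VX (x - c) t) else e1 x).
    assert (Hag : agree c J e1 e2).
    { intros x Hx. unfold e2.
      destruct (Nat.leb_spec c x), (Nat.ltb_spec x (c + J)); auto; lia. }
    destruct (HA' e2 Hag) as (e & He & HB). exists e.
    assert (eM : forall j, j < J -> e (vM j) = phi (VM j)).
    { intros j Hj. rewrite He, Hag, H1; auto; unfold c; unfold_vars; lia. }
    assert (eS : forall q, q <= Q -> e (vS q) = phi (VS q)).
    { intros j Hj. rewrite He, Hag, H2; auto; unfold c; unfold_vars; lia. }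
    assert (e0 : at_row K phi e v0 0).
    { intros j Hj. rewrite He, Hag, H3; auto; unfold c; unfold_vars; lia. }
    assert (eX : at_row K phi e vX t).
    { intros j Hj. rewrite He by (unfold_vars; lia). unfold e2.
      replace (vX j - c) with j by (unfold c; unfold_vars; lia).
      destruct (Nat.leb_spec c (vX j)), (Nat.ltb_spec (vX j) (c + J)); auto;
        unfold c in *; unfold_vars_in H; unfold_vars_in H0; lia. }
    split; [|split; [|split; [|split]]]; auto.
    intro z. specialize (HB z). unfold body in HB. cbn [sat] in HB.
    apply HB. apply (row_intro K phi t E Ht) with (s := t); auto.
    - intros j Hj. rewrite with_z_lt; auto. unfold_vars; lia.
    - intros j Hj. rewrite with_z_lt; auto. unfold_vars; lia.
    - intros j Hj. rewrite with_z_lt; auto. unfold_vars; lia. }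
  assert (Hrun : forall t, t <= T -> exists phi, embeds K phi t /\ closed_at K phi t /\
    (forall j, j < J -> e1 (vM j) = phi (VM j)) /\
    (forall q, q <= Q -> e1 (vS q) = phi (VS q)) /\ at_row K phi e1 v0 0).
  { induction t as [|t IH]; intro Ht; [exact Hinit|].
    destruct IH as (phi & E & C & H1 & H2 & H3); [lia|].
    destruct (Hext t phi ltac:(lia) E H1 H2 H3) as (e & eM & eS & e0 & eX & HB).
    destruct (next_row_elim K phi t e E C Ht eM eS e0 eX) as (E' & C').
    { intro z. apply HB. rewrite !with_z_lt by (unfold_vars; lia).
      rewrite (state_iff K phi t E ltac:(lia) e eS vX t Q) by auto.
      pose proof (run_live _ _ _ _ _ R t Ht). lia. }
    eexists; split; [exact E'|]. split; [exact C'|]. split; [|split].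
    - intros j Hj. rewrite extend_old; auto.
    - intros j Hj. rewrite extend_old; auto.
    - intros j Hj. rewrite extend_old; auto. simpl; lia. }
  destruct (Hrun T (le_n T)) as (phi & E & C & H1 & H2 & H3).
  destruct (Hext T phi (le_n T) E H1 H2 H3) as (e & eM & eS & e0 & eX & HB).
  (* At time [T] the halting clause applies: [w] is a marker, or it satisfies [upto] and is in the
     image by closedness. *)
  exists phi. split; auto. intro w. destruct (HB w) as [HQ _].
  destruct HQ as [HQ|HQ].
  - rewrite !with_z_lt by (unfold_vars; lia).
    apply (state_iff K phi T E (le_n T) e eS vX T Q); auto.
    apply (run_halt _ _ _ _ _ R).
  - apply sat_marker in HQ as [(j & Hj & HQ)|(q & Hq & HQ)];
      rewrite with_z_eq, with_z_lt in HQ by (unfold_vars; lia).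
    + exists (VM j). split; auto. now rewrite HQ, eM.
    + exists (VS q). split; auto. now rewrite HQ, eS.
  - apply (upto_old K phi T (le_n T)) in HQ as (a & Ha & Hw); auto.
    + rewrite with_z_eq in Hw. eauto.
    + intros j Hj. rewrite with_z_lt; auto. unfold_vars; lia.
    + intros j Hj. rewrite with_z_lt; auto. unfold_vars; lia.
Qed.

Lemma sentence_intro K phi env : embeds K phi T ->
  (forall w, exists a, dom T a /\ w = phi a) -> sat K env (sentence m p).
Proof.
  intros E Hsur. pose proof sorts_ge as HJ.
  set (c := J + S Q + J).
  set (e1 := fun x => if x <? J then phi (VM x) else if x <? J + S Q then phi (VS (x - J))
                      else if x <? c then phi (VX (x - (J + S Q)) 0) else env x).
  unfold sentence. apply sat_exs. exists e1. split.
  { intros x Hx. unfold e1. fold c in Hx.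
    destruct (Nat.ltb_spec x J), (Nat.ltb_spec x (J + S Q)), (Nat.ltb_spec x c);
      auto; unfold c in *; lia. }
  apply sat_alls. intros e2 H2. apply sat_exs.
  (* Witnesses for [Y] and [U] are due for every tuple [X]. If [X] is a non-halting row, its time is
     unique by injectivity and determines them; otherwise anything will do. *)
  assert (Hrow : exists f g : nat -> V K, forall s, at_row K phi e2 vX s -> s < T ->
    forall j, j < J -> f j = phi (VX j (S s)) /\ g j = phi (VX j (pivot s))).
  { destruct (classic (exists s, at_row K phi e2 vX s /\ s < T)) as [(s & Hs & HsT)|N].
    - exists (fun j => phi (VX j (S s))), (fun j => phi (VX j (pivot s))).
      intros s' Hs' HsT' j Hj. replace s' with s; auto.
      assert (X : phi (VX j s) = phi (VX j s')) by (rewrite <- Hs, <- Hs'; auto).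
      apply (embeds_inj _ _ _ E) in X; [congruence|simpl; lia|simpl; lia].
    - exists e2, e2. intros s Hs HsT. exfalso; eauto. }
  destruct Hrow as (f & g & Hfg).
  set (d := c + J).
  set (e3 := fun x => if (d <=? x) && (x <? d + J) then f (x - d)
                   else if (d + J <=? x) && (x <? d + J + J) then g (x - (d + J)) else e2 x).
  exists e3.
  assert (H3 : agree d (J + J) e2 e3).
  { intros x Hx. unfold e3.
    destruct (Nat.leb_spec d x), (Nat.ltb_spec x (d + J)),
      (Nat.leb_spec (d + J) x), (Nat.ltb_spec x (d + J + J)); auto; lia. }
  split; [exact H3|]. intro z. change (sat K (with_z e3 z) (body m p)).
  destruct (Hsur z) as (a & Ha & Hz).
  assert (eM : forall j, j < J -> with_z e3 z (vM j) = phi (VM j)).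
  { intros j Hj. rewrite with_z_lt, H3, H2 by (unfold d, c; unfold_vars; lia).
    unfold e1, var_M. now rewrite (proj2 (Nat.ltb_lt j J) Hj). }
  assert (eS : forall q, q <= Q -> with_z e3 z (vS q) = phi (VS q)).
  { intros j Hj. rewrite with_z_lt, H3, H2 by (unfold d, c; unfold_vars; lia).
    unfold e1, var_S. replace (J + j - J) with j by lia.
    destruct (Nat.ltb_spec (J + j) J), (Nat.ltb_spec (J + j) (J + S Q)); auto; lia. }
  assert (e0 : at_row K phi (with_z e3 z) v0 0).
  { intros j Hj. rewrite with_z_lt, H3, H2 by (unfold d, c; unfold_vars; lia).
    unfold e1, var_0. replace (J + S Q + j - (J + S Q)) with j by lia.
    destruct (Nat.ltb_spec (J + S Q + j) J), (Nat.ltb_spec (J + S Q + j) (J + S Q)),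
      (Nat.ltb_spec (J + S Q + j) c); auto; unfold c in *; lia. }
  assert (eX : forall j, j < J -> with_z e3 z (vX j) = e2 (vX j)).
  { intros j Hj. rewrite with_z_lt, H3 by (unfold d, c; unfold_vars; lia). auto. }
  assert (eY : forall j, j < J -> with_z e3 z (vY j) = f j).
  { intros j Hj. rewrite with_z_lt by (unfold_vars; lia). unfold e3.
    replace (vY j) with (d + j) by (unfold d, c; unfold_vars; lia).
    replace (d + j - d) with j by lia.
    destruct (Nat.leb_spec d (d + j)), (Nat.ltb_spec (d + j) (d + J)); auto; lia. }
  assert (eU : forall j, j < J -> with_z e3 z (vU j) = g j).
  { intros j Hj. rewrite with_z_lt by (unfold_vars; lia). unfold e3.
    replace (vU j) with (d + J + j) by (unfold d, c; unfold_vars; lia).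
    replace (d + J + j - (d + J)) with j by lia.
    destruct (Nat.leb_spec d (d + J + j)), (Nat.ltb_spec (d + J + j) (d + J)),
      (Nat.leb_spec (d + J) (d + J + j)), (Nat.ltb_spec (d + J + j) (d + J + J)); auto; lia. }
  assert (ez : with_z e3 z vZ = phi a) by (rewrite with_z_eq; exact Hz).
  unfold body. cbn [sat]. split.
  { apply (init_intro K phi T E (le_n T) (with_z e3 z) eM eS a); auto. }
  intro Hrow. apply (row_elim K phi T E (le_n T) (with_z e3 z) eM) in Hrow as (s & Hs & Hat).
  2: { intros j Hj. apply Hsur. }
  rewrite (state_iff K phi T E (le_n T) (with_z e3 z) eS vX s Q) by auto.
  destruct (Nat.eq_dec s T) as [->|N].
  - rewrite (run_halt _ _ _ _ _ R). split; [intros _|tauto].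
    destruct a as [i|q|i r].
    + left. apply sat_marker. left. exists i. rewrite ez, eM; auto.
    + left. apply sat_marker. right. exists q. rewrite ez, eS; auto.
    + right. apply (upto_iff K phi T E (le_n T) (with_z e3 z) eM vX T vZ (VX i r)); auto.
      simpl in Ha. exists i, r. tauto.
  - pose proof (run_live _ _ _ _ _ R s ltac:(lia)). split; [lia|intros _].
    assert (Hat2 : at_row K phi e2 vX s) by (intros j Hj; rewrite <- eX; auto).
    apply (next_row_intro K phi T E (le_n T) (with_z e3 z) eM eS s a); auto; try lia.
    + intros j Hj. rewrite eY by auto. apply (Hfg s Hat2 ltac:(lia) j Hj).
    + intros j Hj. rewrite eU by auto. apply (Hfg s Hat2 ltac:(lia) j Hj).
Qed.

(** * The graph of the run and its definition by the sentence *)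

Lemma edge_sym a b : edge a b -> edge b a.
Proof. unfold edge. tauto. Qed.

Lemma edge_irr a : ~ edge a a.
Proof. destruct a; unfold edge; simpl; lia. Qed.

Lemma dom_marker : dom T (VM 0).
Proof. simpl. unfold sorts; lia. Qed.

Definition run_graph : graph := {|
  V := {a : vertex | dom T a};
  adj := fun a b => edge (proj1_sig a) (proj1_sig b);
  adj_sym := fun a b => edge_sym _ _;
  adj_irr := fun a => edge_irr _;
  V_inh := inhabits (exist _ _ dom_marker)
|}.

Lemma dom_dec a : {dom T a} + {~ dom T a}.
Proof.
  destruct a as [j|q|j s]; simpl.
  - apply lt_dec.
  - apply le_dec.
  - destruct (lt_dec j J), (le_dec s T); [left; auto|right; tauto..].
Qed.

(** Outside the domain a dummy value is taken; [embeds] asks nothing there. *)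
Definition to_run (a : vertex) : V run_graph :=
  match dom_dec a with
  | left H => exist _ a H
  | right _ => exist _ _ dom_marker
  end.

Lemma proj1_to_run a : dom T a -> proj1_sig (to_run a) = a.
Proof. intro H. unfold to_run. now destruct (dom_dec a). Qed.

Lemma to_run_proj1 (w : V run_graph) : w = to_run (proj1_sig w).
Proof.
  destruct w as [a H]; unfold to_run; simpl. destruct (dom_dec a); [|tauto].
  f_equal. apply proof_irrelevance.
Qed.

Lemma embeds_run : embeds run_graph to_run T.
Proof.
  split; intros a b Ha Hb.
  - simpl. now rewrite !proj1_to_run.
  - intro X. apply (f_equal (@proj1_sig _ _)) in X. now rewrite !proj1_to_run in X.
Qed.

(** Any model, of whatever cardinality, receives an embedding of the whole run that is onto; a
    choice of preimages makes it an isomorphism. *)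
Lemma run_graph_defined : defines (sentence m p) run_graph.
Proof.
  split.
  - intro env. apply (sentence_intro run_graph to_run); [apply embeds_run|].
    intro w. exists (proj1_sig w). split; [apply proj2_sig|apply to_run_proj1].
  - intros H Hiso HA. apply Hiso. destruct (V_inh H) as [h].
    destruct (sentence_elim H (fun _ => h) (HA _)) as (phi & E & Hsur).
    set (pick w := proj1_sig (constructive_indefinite_description _ (Hsur w))).
    assert (Hpick : forall w, dom T (pick w) /\ w = phi (pick w)).
    { intro w. unfold pick. now destruct (constructive_indefinite_description _ (Hsur w)). }
    exists (fun w => to_run (pick w)), (fun a => phi (proj1_sig a)). split; [|split].
    + intro w. rewrite proj1_to_run by apply Hpick. symmetry. apply Hpick.
    + intro a. transitivity (to_run (proj1_sig a)); [|symmetry; apply to_run_proj1].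
      f_equal. apply (embeds_inj _ _ _ E); [apply Hpick|apply proj2_sig|].
      symmetry. apply Hpick.
    + intros w w'. simpl. rewrite !proj1_to_run by apply Hpick.
      rewrite <- (embeds_adj _ _ _ E) by apply Hpick.
      now rewrite <- !(proj2 (Hpick _)).
Qed.

(** The tokens alone are [T + 1] vertices; no exact count is required. *)
Lemma run_graph_size : exists n, T < n /\ has_n_vertices run_graph n.
Proof.
  pose proof sorts_ge as HJ.
  assert (dec : forall a b : vertex, {a = b} + {a <> b}) by (repeat decide equality).
  set (l := nodup dec (map VM (seq 0 J) ++ map VS (seq 0 (S Q)) ++
                       flat_map (fun j => map (VX j) (seq 0 (S T))) (seq 0 J))).
  assert (Hl : forall a, In a l <-> dom T a).
  { intro a. unfold l. rewrite nodup_In, !in_app_iff, !in_map_iff, in_flat_map.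
    split.
    - intros [(j & <- & H)|[(q & <- & H)|(j & Hj & H)]]; [| |apply in_map_iff in H as (s & <- & H)];
        apply in_seq in H; try apply in_seq in Hj; simpl; lia.
    - destruct a as [j|q|j s]; cbn [dom]; intro H.
      + left. exists j. split; auto. apply in_seq; lia.
      + right; left. exists q. split; auto. apply in_seq; lia.
      + right; right. exists j. split; [apply in_seq; lia|].
        apply (in_map (VX j) (seq 0 (S T)) s), in_seq; lia. }
  assert (Hnd : NoDup l) by apply NoDup_nodup.
  exists (length l). split.
  - enough (L : length (map (VX 1) (seq 0 (S T))) <= length l)
      by (rewrite length_map, length_seq in L; lia).
    apply NoDup_incl_length.
    + apply NoDup_map_NoDup_ForallPairs; [|apply seq_NoDup].
      intros x y _ _ X. congruence.
    + intros a Ha. apply in_map_iff in Ha as (s & <- & Hs). apply Hl.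
      apply in_seq in Hs. simpl; lia.
  - assert (Hd : forall i, i < length l -> dom T (nth i l (VM 0)))
      by (intros i Hi; now apply Hl, nth_In).
    exists (fun i => to_run (nth i l (VM 0))). split.
    + intro v. assert (Hv : In (proj1_sig v) l) by (apply Hl, proj2_sig).
      destruct (In_nth _ _ (VM 0) Hv) as (i & Hi & Hn). exists i. split; auto.
      rewrite Hn. symmetry. apply to_run_proj1.
    + intros i j Hi Hj X. apply (embeds_inj _ _ _ embeds_run) in X; auto.
      now apply (proj1 (NoDup_nth l (VM 0)) Hnd).
Qed.

(** * Syntactic form of the sentence *)

Lemma basic_lit n b A : basic n A -> basic n (lit b A).
Proof. now destruct b. Qed.

Lemma basic_row n f : J + S Q <= n -> (forall j, j < J -> f j < n) -> basic n (row m p f).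
Proof.
  intros Hn Hf. pose proof sorts_ge as HJ.
  split; [|split]; (apply basic_conjn; [lia|]; intros i Hi);
    (apply basic_conjn; [lia|]; intros j Hj); try apply basic_lit;
    (split; [apply Hf|try apply Hf]); unfold_vars; unfold sorts in *; lia.
Qed.

Lemma basic_state n f s : J + S Q <= n -> f 0 < n -> basic n (state m p f s).
Proof.
  intros Hn Hf. apply basic_conjn; [lia|]. intros. apply basic_lit.
  split; auto. unfold_vars; lia.
Qed.

Lemma basic_in_row n f w : w < n -> (forall j, j < J -> f j < n) -> basic n (in_row m f w).
Proof. intros Hw Hf. apply basic_disjn; [lia|]. intros. split; auto. Qed.

Lemma basic_upto n f w : J + S Q <= n -> w < n -> (forall j, j < J -> f j < n) ->
  basic n (upto m f w).
Proof.
  intros Hn Hw Hf. pose proof sorts_ge as HJ. split; [now apply basic_in_row|].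
  repeat split; try apply Hf; unfold_vars; lia.
Qed.

Ltac var_tac := intros; pose proof sorts_ge; unfold_vars; unfold sorts in *; lia.

Lemma basic_update x A : basic (S vZ) A -> basic (S vZ) (update m p x A).
Proof.
  intro HA. apply basic_conjn; [lia|]. intros i Hi.
  destruct (i =? x); auto. repeat split; var_tac.
Qed.

Lemma basic_token : basic (S vZ) (token m p).
Proof. split; [apply basic_upto; var_tac|split; var_tac]. Qed.

Lemma basic_change x A B : x < m -> basic (S vZ) A -> basic (S vZ) B ->
  basic (S vZ) (change m p x A B).
Proof.
  intros Hx HA HB. split; [apply basic_token|]. apply basic_update.
  repeat split; auto; var_tac.
Qed.

Lemma basic_effect i : instr_ok m Q i -> basic (S vZ) (effect m p i).
Proof.
  destruct i as [x j|x j1 j2]; simpl; intros Hok.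
  - split; [apply basic_state; var_tac|].
    apply basic_change; [tauto|..]; repeat split; var_tac.
  - split; (split; [split; var_tac|]).
    + split; [apply basic_state; var_tac|]. split; [apply basic_token|].
      apply basic_update. split; lia.
    + split; [apply basic_state; var_tac|].
      apply basic_change; [tauto|..]; repeat split; var_tac.
Qed.

Lemma basic_body : basic (S vZ) (body m p).
Proof.
  assert (Hinit : basic (S vZ) (init m p)).
  { split; [|split; [|split; [|split; [|split; [|split]]]]].
    1-3: (apply basic_conjn; [lia|]; intros i Hi);
      (apply basic_conjn; [lia|]; intros j Hj); split; try apply basic_lit; split; var_tac.
    - apply basic_row; var_tac.
    - apply basic_state; var_tac.
    - apply basic_upto; var_tac.
    - apply basic_in_row; var_tac. }
  split; [exact Hinit|]. split; [apply basic_row; var_tac|].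
  split; (split; [split; var_tac|]).
  - split; [|apply basic_upto; var_tac].
    split; [apply basic_in_row; var_tac|].
    apply basic_disjn; [lia|]. split; var_tac.
  - split; [apply basic_row; var_tac|].
    split; [apply basic_row; var_tac|].
    split; [apply basic_conjn; [lia|]; intros; apply basic_upto; var_tac|].
    split; [apply basic_conjn; [lia|]; intros; apply basic_upto; var_tac|].
    split; [split; [apply basic_upto; var_tac|]; split;
            [apply basic_upto; var_tac|apply basic_in_row; var_tac]|].
    split; [split; [apply basic_upto; var_tac|]|].
    + split; [split; var_tac|]. split; [split; var_tac|].
      split; [repeat split; var_tac|]. split; [split; var_tac|].
      apply basic_conjn; [lia|]. intros; split; var_tac.
    + apply basic_conjn; [lia|]. intros q Hq. split; [split; var_tac|].
      apply basic_effect. apply (run_regs _ _ _ _ _ R q). now apply nth_error_nth'.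
Qed.

Lemma qprefix_exs A n : forall a, qprefix (exs a n A) = repeat true n ++ qprefix A.
Proof. induction n; intro a; simpl; [|rewrite IHn]; auto. Qed.

Lemma qprefix_alls A n : forall a, qprefix (alls a n A) = repeat false n ++ qprefix A.
Proof. induction n; intro a; simpl; [|rewrite IHn]; auto. Qed.

Lemma matrix_exs A n : forall a, matrix (exs a n A) = matrix A.
Proof. induction n; intro a; simpl; auto. Qed.

Lemma matrix_alls A n : forall a, matrix (alls a n A) = matrix A.
Proof. induction n; intro a; simpl; auto. Qed.

Lemma free_exs x A n : forall a, free x (exs a n A) -> free x A /\ ~ a <= x < a + n.
Proof.
  induction n; intro a; simpl; intro H; [split; auto; lia|].
  destruct H as [N H]. apply IHn in H. split; [tauto|lia].
Qed.

Lemma free_alls x A n : forall a, free x (alls a n A) -> free x A /\ ~ a <= x < a + n.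
Proof.
  induction n; intro a; simpl; intro H; [split; auto; lia|].
  destruct H as [N H]. apply IHn in H. split; [tauto|lia].
Qed.

(** A block of equal quantifiers adds at most one change, at its right end; the three blocks before
    the last universal quantifier thus give at most 3. *)
Lemma changes_repeat b n l : changes (repeat b n ++ l) <= 1 + changes l.
Proof.
  induction n as [|n IH]; simpl; [lia|].
  destruct n as [|n]; simpl in *.
  - destruct l as [|c l]; simpl; [lia|]. destruct (Bool.eqb b c); lia.
  - rewrite Bool.eqb_reflx. exact IH.
Qed.

Lemma qfree_prefix A : qfree A -> qprefix A = [] /\ matrix A = A.
Proof. destruct A; simpl; auto; tauto. Qed.

Lemma run_sentence_pre3 : defines_pre3 (sentence m p) run_graph.
Proof.
  destruct (qfree_prefix _ (basic_qfree _ _ basic_body)) as [Hp Hm].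
  split; [|split; [|split]].
  - intros x H. unfold sentence in H. apply free_exs in H as [H N1].
    apply free_alls in H as [H N2]. apply free_exs in H as [[N4 H] N3].
    apply (basic_free _ _ _ basic_body) in H. unfold var_Z in *. lia.
  - unfold prenex, sentence. rewrite matrix_exs, matrix_alls, matrix_exs. cbn [matrix].
    rewrite Hm. eapply basic_qfree, basic_body.
  - unfold alternation, sentence. rewrite qprefix_exs, qprefix_alls, qprefix_exs.
    cbn [qprefix]. rewrite Hp.
    etransitivity; [apply changes_repeat|]. apply le_n_S.
    etransitivity; [apply changes_repeat|]. apply le_n_S. apply changes_repeat.
  - apply run_graph_defined.
Qed.

End Model.

(** * Length of the sentence *)

Section Length.

Context (m : nat) (p : list instr).

(** The number of markers. It bounds the range of every conjunction and disjunction, so a doubly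
    indexed table has at most [N * N] entries. *)
Let N := sorts m + S (length p).

Lemma flen_conjn_le k h b : k <= N -> (forall i, i < k -> flen (h i) <= b) ->
  flen (conjn k h) <= 3 + N * (3 + b).
Proof.
  intros Hk H. pose proof (flen_conjn k h b H). pose proof (Nat.mul_le_mono_r k N (3 + b) Hk).
  lia.
Qed.

Lemma flen_disjn_le k h b : k <= N -> (forall i, i < k -> flen (h i) <= b) ->
  flen (disjn k h) <= 4 + N * (3 + b).
Proof.
  intros Hk H. pose proof (flen_disjn k h b H). pose proof (Nat.mul_le_mono_r k N (3 + b) Hk).
  lia.
Qed.

Lemma flen_lit_le b A k : flen A <= k -> flen (lit b A) <= 1 + k.
Proof. pose proof (flen_lit b A). lia. Qed.

Ltac bound := unfold N, sorts in *; lia.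

(** Replaces a conjunction length by an opaque number with a bound, so that the arithmetic tactics
    see few and simple terms. *)
Ltac bound_conjn b tac :=
  match goal with |- context [flen (conjn ?k ?h)] =>
    let H := fresh in let x := fresh in
    assert (H : flen (conjn k h) <= 3 + N * (3 + b))
      by (apply flen_conjn_le; [bound|intros; tac]);
    set (x := flen (conjn k h)) in *; clearbody x
  end.

Lemma N_ge : 4 <= N.
Proof. bound. Qed.

Lemma flen_row f : flen (row m p f) <= 100 * (N * N).
Proof.
  unfold row. cbn [flen]. pose proof N_ge.
  (* A literal has at most 4 symbols, and each member of a conjunction costs 3 more. *)
  bound_conjn (3 + N * 7) ltac:(apply flen_conjn_le; [bound|intros; now apply flen_lit_le]).
  bound_conjn (3 + N * 7) ltac:(apply flen_conjn_le; [bound|intros; now apply flen_lit_le]).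
  bound_conjn (3 + N * 7) ltac:(apply flen_conjn_le; [bound|intros; simpl; lia]).
  nia.
Qed.

Lemma flen_state f s : flen (state m p f s) <= 10 * N.
Proof.
  unfold state. pose proof N_ge.
  bound_conjn 4 ltac:(now apply flen_lit_le). lia.
Qed.

Lemma flen_in_row f w : flen (in_row m f w) <= 10 * N.
Proof.
  unfold in_row. pose proof N_ge.
  etransitivity; [apply flen_disjn_le with (b := 3); [bound|auto]|lia].
Qed.

Lemma flen_upto f w : flen (upto m f w) <= 20 * N.
Proof.
  unfold upto. cbn [flen]. pose proof (flen_in_row f w). pose proof N_ge. lia.
Qed.

Lemma flen_marker w : flen (marker m p w) <= 21 * N.
Proof.
  unfold marker. cbn [flen]. pose proof (flen_in_row var_M w). pose proof N_ge.
  pose proof (flen_disjn_le (S (length p)) (fun q => FEq w (var_S m q)) 3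
                ltac:(bound) ltac:(auto)). lia.
Qed.

Lemma flen_init : flen (init m p) <= 300 * (N * N).
Proof.
  unfold init. cbn [flen]. pose proof N_ge.
  (* An entry consists of two literals of at most 4 symbols joined by a connective, 11 in all, and 3
     more are spent on joining it to the conjunction. *)
  bound_conjn (3 + N * 14) ltac:(apply flen_conjn_le; [bound|intros; cbn [flen];
    match goal with |- context [lit ?b ?A] => pose proof (flen_lit b A) end; simpl in *; lia]).
  bound_conjn (3 + N * 14) ltac:(apply flen_conjn_le; [bound|intros; simpl; lia]).
  bound_conjn (3 + N * 14) ltac:(apply flen_conjn_le; [bound|intros; cbn [flen];
    match goal with |- context [lit ?b ?A] => pose proof (flen_lit b A) end; simpl in *; lia]).
  pose proof (flen_row (var_0 m p)). pose proof (flen_state (var_0 m p) 0).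
  pose proof (flen_upto (var_0 m p) (var_Z m p)).
  pose proof (flen_in_row (var_0 m p) (var_Z m p)). nia.
Qed.

Lemma flen_update x A : flen A <= 40 -> flen (update m p x A) <= 50 * N.
Proof.
  intro HA. unfold update. pose proof N_ge.
  bound_conjn 40 ltac:(match goal with |- context [?i =? x] => destruct (i =? x) end;
                       [exact HA|simpl; lia]). lia.
Qed.

Lemma flen_token : flen (token m p) <= 25 * N.
Proof.
  unfold token. cbn [flen]. pose proof (flen_upto (var_X m p) (var_Z m p)).
  pose proof N_ge. lia.
Qed.

Lemma flen_change x A B : flen A <= 9 -> flen B <= 9 ->
  flen (change m p x A B) <= 80 * N.
Proof.
  intros HA HB. unfold change. cbn [flen]. pose proof flen_token. pose proof N_ge.
  match goal with |- context [update m p x ?C] =>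
    pose proof (flen_update x C ltac:(cbn [flen]; lia)) end. lia.
Qed.

Lemma flen_effect i : flen (effect m p i) <= 200 * N.
Proof.
  pose proof N_ge. pose proof flen_token.
  pose proof (flen_update m (FEq 0 0) ltac:(simpl; lia)).
  destruct i as [x j|x j1 j2]; unfold effect; cbn [flen] in *.
  - pose proof (flen_state (var_Y m p) j).
    pose proof (flen_change x (below_u m p) (upto_u m p) ltac:(simpl; lia) ltac:(simpl; lia)).
    lia.
  - pose proof (flen_state (var_Y m p) j1). pose proof (flen_state (var_Y m p) j2).
    pose proof (flen_change x (upto_u m p) (below_u m p) ltac:(simpl; lia) ltac:(simpl; lia)).
    lia.
Qed.

Lemma flen_next_row : flen (next_row m p) <= 600 * (N * N).
Proof.
  unfold next_row. cbn [flen]. pose proof N_ge.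
  pose proof (flen_row (var_Y m p)). pose proof (flen_row (var_U m p)).
  pose proof (flen_upto (var_X m p) (var_Z m p)).
  pose proof (flen_upto (var_Y m p) (var_Z m p)).
  pose proof (flen_in_row (var_Y m p) (var_Z m p)).
  bound_conjn (20 * N) ltac:(apply flen_upto).
  bound_conjn (21 * N) ltac:(cbn [flen];
    match goal with |- context [upto m ?f ?w] => pose proof (flen_upto f w) end; lia).
  bound_conjn 4 ltac:(simpl; lia).
  bound_conjn (202 * N) ltac:(cbn [flen];
    match goal with |- context [effect m p ?i] => pose proof (flen_effect i) end; lia).
  nia.
Qed.

Lemma flen_exs A n : forall a, flen (exs a n A) = 2 * n + flen A.
Proof. induction n; intro a; simpl; [|rewrite IHn]; lia. Qed.

Lemma flen_alls A n : forall a, flen (alls a n A) = 2 * n + flen A.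
Proof. induction n; intro a; simpl; [|rewrite IHn]; lia. Qed.

Lemma flen_sentence : flen (sentence m p) <= 1200 * (N * N).
Proof.
  unfold sentence. rewrite flen_exs, flen_alls, flen_exs. cbn [flen].
  unfold body. cbn [flen].
  pose proof flen_init. pose proof (flen_row (var_X m p)). pose proof flen_next_row.
  pose proof (flen_marker (var_Z m p)). pose proof (flen_upto (var_X m p) (var_Z m p)).
  assert (4 <= N) by bound. assert (sorts m + S (length p) = N) by reflexivity.
  nia.
Qed.

End Length.

(** * Outgrowing a recursive bound *)

Lemma has_least (P : nat -> Prop) n : P n -> exists k, P k /\ forall j, P j -> k <= j.
Proof.
  induction n as [n IH] using lt_wf_ind. intro Hn.
  destruct (classic (exists k, k < n /\ P k)) as [(k & Hk & HP)|No].
  - eauto.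
  - exists n. split; auto. intros j Hj. destruct (le_lt_dec n j); auto.
    exfalso; eauto.
Qed.

(** The left side is at most [4800 * (k * k)], and [4800 < 70 * 70]; this is where 70 comes from. *)
Lemma quadratic_lt_quartic N k : N <= 2 * k -> 70 <= k ->
  1200 * (N * N) < (k * k) * (k * k).
Proof.
  intros HN Hk.
  pose proof (Nat.mul_le_mono _ _ _ _ HN HN). pose proof (Nat.mul_le_mono _ _ _ _ Hk Hk).
  nia.
Qed.

Theorem theorem5p2 :
  ~ (exists f : nat -> nat,
       general_recursive f /\
       forall n, 1 <= n -> forall m, s_pre3 n m -> n <= f m).
Proof.
  intros (f & [c Hc] & Hf).
  destruct (machine_for (RComp (rc_sum c) [RComp rc_square [rc_square]])
              (fun k => sum_below f ((k * k) * (k * k)))) as (m & q & HM).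
  { intro k. econstructor; [|apply reval_sum, Hc]. econstructor; [|constructor].
    econstructor; [|apply reval_square]. econstructor; [|constructor]. apply reval_square. }
  (* The number of markers is [a + k], hence at most [2 * k]. *)
  set (a := sorts m + S q). set (k := a + 70).
  destruct (HM k) as (p & Hp & Hok & r & x & [n Hn] & Hr).
  destruct (machine_run p m n r Hok Hn) as (T & st & rg & R & HT).
  destruct (run_graph_size m p T st rg) as (v & Hv & Hsize).
  pose proof (run_sentence_pre3 m p T st rg R) as Hdef.
  set (G := run_graph m p T st rg) in *.
  destruct (has_least (fun l => exists G A, has_n_vertices G v /\ defines_pre3 A G /\ flen A = l)
              (flen (sentence m p))) as (l & Hl & Hmin); [eauto|].
  assert (Hs : s_pre3 v l).
  { split; auto. intros G' A H1 H2. apply Hmin; eauto. }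
  assert (Hlen : l < (k * k) * (k * k)).
  { apply Nat.le_lt_trans with (flen (sentence m p)); [apply Hmin; eauto|].
    eapply Nat.le_lt_trans; [apply flen_sentence|]. rewrite Hp.
    apply quadratic_lt_quartic; unfold k, a; lia. }
  (* The contradictory chain: [v] is at most [f l], which is at most the sum computed by the
     machine, which is at most [T], which is less than [v]. *)
  specialize (Hf v ltac:(lia) l Hs). specialize (HT x).
  pose proof (le_sum_below f _ _ Hlen). lia.
Qed.
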